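(* There exists $s_0>0$ depending only on $H$ such that the singular initial value problem $$(1-2ns)\gamma'(s)-H(\gamma(s))+4\,\frac{s\gamma'(s)+s^2\gamma''(s)}{1+4s^2\gamma'(s)^2}=0,\qquad \gamma(0)=0,$$ has a unique solution $\gamma\in C^\infty[0,s_0]$. Moreover, $\gamma^{(k)}(0)=A_k$ for $k=1,2,\dots$.
   Context: Let $n\ge2$ and let $\Gamma\subset S^n$ be a compact connected embedded isoparametric hypersurface (constant principal curvatures), strictly mean convex with respect to the inner orientation. $H(d)$ denotes the (constant) mean curvature (sum of principal curvatures) of the parallel hypersurface $\Gamma_d$ at distance $d$ on the outer side of $\Gamma$, i.e. $H(d)=\Delta_{S^n}d$ on $\Gamma_d$ where $d$ is the distance to $\Gamma$; the outer side is the one with $H(0)>0$. There is $d_0>0$ with $H>0$, $H'<0$ on $[0,d_0)$ and $H(d_0)=0$; $H$ is real analytic near $[0,d_0]$. Solutions $\gamma$ are understood to take values in $[0,d_0)$, where $H(\gamma)$ is defined. The numbers $A_k$ are the coefficients of the formal power series $\sum_{k\ge1}\frac{A_k}{k!}s^k$ that formally solves the singular initial value problem $$(1-2ns)\gamma'(s)-H(\gamma(s))+4\,\frac{s\gamma'(s)+s^2\gamma''(s)}{1+4s^2\gamma'(s)^2}=0,\qquad \gamma(0)=0;$$ $A_1=H(0)$ and $A_{k+1}$ is determined recursively by $A_1,\dots,A_k$ (by differentiating this differential equation $k$ times and setting $s=0$). *)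

(* Defs.v *)
From mathcomp Require Import all_boot all_order all_algebra.
From mathcomp Require Import all_classical all_reals all_analysis.
From mathcomp Require Import ring.
From mathcomp Require Export Rstruct Rstruct_topology.

Set Implicit Arguments.
Unset Strict Implicit.
Unset Printing Implicit Defensive.

Import Order.TTheory GRing.Theory Num.Theory.
Import numFieldNormedType.Exports.

Local Open Scope classical_set_scope.
Local Open Scope ring_scope.

(** * Hypersurfaces of the unit sphere S^n of R^(n+1) *)

Section Sphere.
Context {R : realType} {n : nat}.
Local Notation E := 'rV[R]_n.+1.

Definition dot (u v : E) : R := \sum_i u 0 i * v 0 i.

Definition sphere : set E := [set x | dot x x = 1].

Fixpoint iter_derive {W : normedModType R} (f : E -> W) (vs : seq E) : E -> W :=
  if vs is v :: vs' then 'D_v (iter_derive f vs') else f.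

(** C^oo on an open set [U]: all iterated directional derivatives exist and
    are continuous. *)
Definition smooth_on {W : normedModType R} (U : set E) (f : E -> W) : Prop :=
  forall (vs : seq E) (x : E), U x ->
    {for x, continuous (iter_derive f vs)} /\
    forall v, derivable (iter_derive f vs) x v.

(** Near each of its points, [M] is the regular zero set in S^n of a smooth
    function. *)
Definition hypersurface (M : set E) : Prop :=
  M `<=` sphere /\
  forall p, M p -> exists (U : set E) (phi : E -> R^o),
    [/\ open U, U p, smooth_on U phi,
        forall x, U x -> sphere x -> (M x <-> phi x = 0) &
        exists v, dot p v = 0 /\ 'D_v phi p != 0].

Definition tangent (M : set E) (p v : E) : Prop :=
  exists c : R -> E,
    [/\ \forall t \near 0, M (c t), c 0 = p & is_derive (0 : R) (1 : R) c v].

(** [N] is a unit normal field of [M] in S^n.  A smooth field on a closed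
    embedded [M] always extends to a neighbourhood, and only the values of [N]
    on [M] matter below. *)
Definition unit_normal (M : set E) (N : E -> E) : Prop :=
  (exists U, [/\ open U, M `<=` U & smooth_on U N]) /\
  forall p, M p ->
    [/\ dot p (N p) = 0, dot (N p) (N p) = 1 &
        forall v, tangent M p v -> dot (N p) v = 0].

(** [kappa] lists, with multiplicity, the eigenvalues of the shape operator
    [v |-> D_v N] of [M] at [p].  With this sign the curvatures of a small
    geodesic sphere are positive for the normal pointing away from its centre,
    and their sum is the Laplacian of the distance function of gradient [N]. *)
Definition principal_curvatures (M : set E) (N : E -> E) (p : E)
    (kappa : 'I_n.-1 -> R) : Prop :=
  exists e : 'I_n.-1 -> E,
    [/\ forall i, tangent M p (e i),
        forall i j, dot (e i) (e j) = (i == j)%:R &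
        forall i, 'D_(e i) N p = kappa i *: e i].

Definition mean_curvature (M : set E) (N : E -> E) (p : E) (h : R) : Prop :=
  exists2 kappa, principal_curvatures M N p kappa & h = \sum_i kappa i.

(** A compact connected embedded hypersurface with constant principal
    curvatures. *)
Definition isoparametric (G : set E) : Prop :=
  [/\ G !=set0, compact G, connected G, hypersurface G &
      exists N kappa, unit_normal G N /\
        forall p, G p -> principal_curvatures G N p kappa].

(** [G] separates S^n; its sides are the components of the complement. *)
Definition side (G Om : set E) : Prop :=
  exists2 x, (sphere `\` G) x & Om = connected_component (sphere `\` G) x.

(** Geodesic distance of S^n to [G]. *)
Definition sphere_dist (G : set E) (x : E) : R :=
  inf [set acos (dot x y) | y in G].

(** Parallel hypersurface at distance [d] on the side [Om]. *)
Definition parallel (G Om : set E) (d : R) : set E :=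
  [set x | (G `|` Om) x /\ sphere_dist G x = d].

Definition geodesic (p v : E) (t : R) : E := cos t *: p + sin t *: v.

(** [N] points into [Om], in the direction of increasing distance to [G]. *)
Definition points_away (G Om : set E) (d : R) (N : E -> E) : Prop :=
  forall p, parallel G Om d p -> \forall t \near 0^'+,
    Om (geodesic p (N p) t) /\ d < sphere_dist G (geodesic p (N p) t).

Definition parallel_mean_curvature (G Om : set E) (d h : R) : Prop :=
  hypersurface (parallel G Om d) /\
  exists N, [/\ unit_normal (parallel G Om d) N, points_away G Om d N &
    forall p, parallel G Om d p -> mean_curvature (parallel G Om d) N p h].

End Sphere.

(** * One variable: analyticity, smoothness on an interval, the equation *)

Section OneVariable.
Context {R : realType}.
Implicit Types (f H g : R -> R) (I : set R).

Definition analytic_at f (x : R) : Prop :=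
  exists (a : nat -> R) (r : R), 0 < r /\
    forall y, `|y - x| < r -> series (fun k => a k * (y - x) ^+ k) @ \oo --> f y.

(** Derivative relative to [I]: one-sided at an end point of [I]. *)
Definition dquot f (x y : R) : R := (f y - f x) / (y - x).
Definition derivable_in I f (x : R) : Prop := cvg (dquot f x @ within I x^').
Definition derive_in I f (x : R) : R := lim (dquot f x @ within I x^').
Definition derive_in_n I (k : nat) f : R -> R := iter k (derive_in I) f.

Definition smooth_in I f : Prop :=
  forall (k : nat) x, I x -> derivable_in I (derive_in_n I k f) x.

Definition solves_ivp (n : nat) H (d0 s0 : R) (gamma : R -> R) : Prop :=
  let I := `[0, s0]%classic in
  let gamma' := derive_in_n I 1 gamma in
  let gamma'' := derive_in_n I 2 gamma in
  [/\ smooth_in I gamma,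
      forall s, I s -> 0 <= gamma s < d0,
      gamma 0 = 0 &
      forall s, I s ->
        (1 - 2 * n%:R * s) * gamma' s - H (gamma s)
        + 4 * ((s * gamma' s + s ^+ 2 * gamma'' s)
               / (1 + 4 * s ^+ 2 * gamma' s ^+ 2)) = 0].

(** ** Formal power series, given by their coefficients *)

Definition fps_deriv (a : nat -> R) (k : nat) : R := k.+1%:R * a k.+1.

(** multiplication by the variable *)
Definition fps_X (a : nat -> R) (k : nat) : R := if k is k'.+1 then a k' else 0.

Definition fps_mul (a b : nat -> R) (k : nat) : R :=
  \sum_(i < k.+1) a i * b (k - i)%N.

Definition fps_exp (a : nat -> R) (j : nat) : nat -> R :=
  iter j (fps_mul a) (fun k => (k == 0%N)%:R).

(** [h o a] for [a 0 = 0], so that only the powers [a ^ j] with [j <= k]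
    contribute to the coefficient of order [k]. *)
Definition fps_comp (h a : nat -> R) (k : nat) : R :=
  \sum_(j < k.+1) h j * fps_exp a j k.

(** [1 / (1 + u)] for [u 0 = 0] *)
Definition fps_inv1D (u : nat -> R) : nat -> R :=
  fps_comp (fun j => (-1) ^+ j) u.

(** The left-hand side of the equation at the formal series [g], where [h] is
    the Taylor series of [H] at 0. *)
Definition ode_fps (n : nat) (h g : nat -> R) (k : nat) : R :=
  let g' := fps_deriv g in
  let g'' := fps_deriv g' in
  let sg' := fps_X g' in
  fps_deriv g k - 2 * n%:R * sg' k - fps_comp h g k
  + 4 * fps_mul (fun m => sg' m + fps_X (fps_X g'') m)
                (fps_inv1D (fun m => 4 * fps_mul sg' sg' m)) k.

Definition taylor H (k : nat) : R := derive1n k H 0 / k`!%:R.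

(** coefficients of the series [\sum_(k >= 1) A k / k! s^k] *)
Definition egf (A : nat -> R) (k : nat) : R :=
  if k is 0%N then 0 else A k / k`!%:R.

Definition formal_solution (n : nat) H (A : nat -> R) : Prop :=
  forall k, ode_fps n (taylor H) (egf A) k = 0.

(** ** The numbers [A k], [k >= 1], exist and are unique *)

Definition agree (k : nat) (a b : nat -> R) := forall i, (i <= k)%N -> a i = b i.

Lemma agree_mul k a b a' b' :
  agree k a a' -> agree k b b' -> agree k (fps_mul a b) (fps_mul a' b').
Proof.
move=> ha hb i ik; apply: eq_bigr => j _.
by rewrite ha ?hb ?(leq_trans (leq_subr _ _)) // (leq_trans _ ik) // -ltnS.
Qed.

Lemma agree_comp k h a a' :
  agree k a a' -> agree k (fps_comp h a) (fps_comp h a').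
Proof.
move=> ha i ik; apply: eq_bigr => j _; congr (_ * _).
have: agree k (fps_exp a j) (fps_exp a' j).
  by elim: (j : nat) => [//|m IH] /=; apply: agree_mul.
exact.
Qed.

Lemma agree_XD k a a' :
  agree k a a' -> agree k (fps_X (fps_deriv a)) (fps_X (fps_deriv a')).
Proof. by move=> ha [//|i] ik; rewrite /= /fps_deriv ha. Qed.

Lemma agree_XXDD k a a' : agree k a a' ->
  agree k (fps_X (fps_X (fps_deriv (fps_deriv a))))
          (fps_X (fps_X (fps_deriv (fps_deriv a')))).
Proof. by move=> ha [//|[//|i]] ik; rewrite /= /fps_deriv ha. Qed.

Lemma ode_fps_agree n h k a a' : agree k a a' ->
  ode_fps n h a k - ode_fps n h a' k = k.+1%:R * (a k.+1 - a' k.+1).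
Proof.
move=> ha; rewrite /ode_fps.
have hX := agree_XD ha; have hXX := agree_XXDD ha.
rewrite (hX k) // (agree_comp h ha) //.
set u := fps_mul _ _ k; set v := fps_mul _ _ k.
have -> : u = v.
  apply: (@agree_mul k) => // [i ik|]; first by rewrite hX ?hXX.
  apply: agree_comp => i ik; congr (4 * _).
  exact: (agree_mul hX hX).
rewrite /fps_deriv; move: (_.+1%:R) (2 * _ * _) (fps_comp _ _ _) => x y z.
ring.
Qed.

Lemma formal_solution_exists n H : exists A, formal_solution n H A.
Proof.
set h := taylor H.
pose fix approx (k : nat) : nat -> R :=
  if k is k'.+1 then
    fun i => if i == k then - ode_fps n h (approx k') k' / k%:R
             else approx k' i
  else fun=> 0.
have ap0 k i : (k < i)%N -> approx k i = 0.
  elim: k i => [//|k IH] i ki /=; rewrite gtn_eqF //.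
  by apply: IH; apply: ltnW.
pose g i := approx i i.
have apg k : agree k g (approx k).
  elim: k => [|k IH] i; first by rewrite leqn0 => /eqP ->.
  rewrite leq_eqVlt => /orP[/eqP -> //|ik].
  by rewrite IH //= ltn_eqF.
have sol k : ode_fps n h g k = 0.
  have := ode_fps_agree n h (apg k); rewrite (ap0 k k.+1) // subr0.
  rewrite /g /= eqxx mulrCA divff ?pnatr_eq0 // mulr1 => /eqP.
  by rewrite subr_eq addNr => /eqP.
exists (fun k => g k * k`!%:R) => k.
suff -> : egf (fun k => g k * k`!%:R) = g by exact: sol.
apply/funext => -[//|i]; by rewrite /egf mulfK // pnatr_eq0 -lt0n fact_gt0.
Qed.

Lemma formal_solution_unique n H A B :
  formal_solution n H A -> formal_solution n H B ->
  forall k, (1 <= k)%N -> A k = B k.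
Proof.
move=> hA hB.
have AB k : agree k (egf A) (egf B).
  elim: k => [|k IH] i; first by rewrite leqn0 => /eqP ->.
  rewrite leq_eqVlt => /orP[/eqP ->|]; last by rewrite ltnS; apply: IH.
  have := ode_fps_agree n (taylor H) IH; rewrite hA hB subrr => /esym/eqP.
  by rewrite mulf_eq0 pnatr_eq0 /= subr_eq0 => /eqP.
case=> [//|k] _; have := AB k.+1 k.+1 (leqnn _); rewrite /egf.
by apply: mulIf; rewrite invr_eq0 pnatr_eq0 -lt0n fact_gt0.
Qed.

End OneVariable.

(* Main.v *)
Require Import Defs.
From mathcomp Require Import all_boot all_order all_algebra.
From mathcomp Require Import all_classical all_reals all_analysis.
From mathcomp Require Import ring lra.

(** Why the theorem holds.

    The geometric data enter only through [H], so the theorem is a statement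
    about an ordinary differential equation with an irregular singular point at
    0.  With [v = gamma'], clearing the denominator turns the equation into
        [4 s^2 v' + v = H (gamma) + s P (s, H (gamma), v)],
    with [P] a polynomial ([profile_rhs] is the right side).

    The linear equation [4 s^2 y' + y = f].  Its homogeneous solution
    [exp (1 / (4 s))] explodes at 0, so there is exactly one solution of
    polynomial growth, and it satisfies [sup |y| <= sup |f]: both facts come from
    a maximum principle ([singular_max_principle]), and the solution itself is an
    explicit integral ([singular_solve]).

    Existence.  In the nonlinear right side [v] enters only through its integral
    [gamma] and in terms with a factor [s].  On a short interval [0, r] the right
    side therefore hardly changes with [v], the map sending [v] to the bounded
    solution of the linear equation is a contraction, and its fixed point is the
    wanted [v] ([profile_exists]).

    Smoothness.  Away from 0 the equation is regular.  At 0, a solution of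
    [4 s^2 z' + (1 + s b) z = f] growing at most like [s^-2] tends to [f 0]
    ([singular_cont0]).  Differentiating such an equation gives one of the same
    kind for [z'], and [z'] is again [O (s^-2)] by the equation for [z]; hence
    [z] is as smooth as [b] and [f] ([singular_Ck]).  The derivative [v'] solves
    an equation of this kind whose coefficients are as smooth as [v], so [v'] is
    as smooth as [v], and [v] is smooth ([profile_Ck]).

    Uniqueness.  For the differences [eta] of the derivatives and [delta] of the
    solutions the energy [2 s^2 eta^2 + delta^2] satisfies a Gronwall inequality
    up to the singular point ([profile_unique]).

    The derivatives at 0.  A smooth function has its Taylor series as asymptotic
    expansion at 0, and sums, products, quotients and composition with [H] act on
    expansions as the corresponding operations act on formal series.  So the
    Taylor series of [gamma] is a formal solution ([taylor_formal_solution]), and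
    the formal solution is unique. *)

Set Implicit Arguments.
Unset Strict Implicit.
Unset Printing Implicit Defensive.

Import Order.TTheory GRing.Theory Num.Theory.
Import numFieldNormedType.Exports.

Local Open Scope classical_set_scope.
Local Open Scope ring_scope.

(** * Calculus relative to a set of reals *)

Section RelativeDerivative.
Context {R : realType}.
Implicit Types (I : set R) (f g : R -> R) (x l : R).

Definition deriv_in I f x l := dquot f x @ within I x^' --> l.

Definition cont_at_in I f x := f @ within I (nbhs x) --> f x.

Definition cont_in I f := forall x, I x -> cont_at_in I f x.

Lemma nbhs_within_dnbhsE I x (P : R -> Prop) :
  (\forall y \near within I x^', P y) <->
  exists2 d, 0 < d & forall y, I y -> y != x -> `|x - y| < d -> P y.
Proof.
split=> [|[d d0 H]].
  rewrite near_withinE /dnbhs near_withinE => /nbhs_ballP[d /= d0 H].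
  by exists d => // y Iy yx xy; apply: H.
rewrite near_withinE /dnbhs near_withinE; apply/nbhs_ballP; exists d => //= y xy yx Iy.
exact: H.
Qed.

Lemma nbhs_withinE I x (P : R -> Prop) :
  (\forall y \near within I (nbhs x), P y) <->
  exists2 d, 0 < d & forall y, I y -> `|x - y| < d -> P y.
Proof.
split=> [|[d d0 H]].
  rewrite near_withinE => /nbhs_ballP[d /= d0 H].
  by exists d => // y Iy xy; apply: H.
rewrite near_withinE; apply/nbhs_ballP; exists d => //= y xy Iy.
exact: H.
Qed.

Lemma cont_at_inP I f x : cont_at_in I f x <->
  forall e, 0 < e -> exists2 d, 0 < d &
    forall y, I y -> `|x - y| < d -> `|f x - f y| < e.
Proof.
rewrite /cont_at_in; split.
  by move=> /cvgrPdist_lt H e e0; apply/nbhs_withinE; exact: H.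
by move=> H; apply/cvgrPdist_lt => e e0; apply/nbhs_withinE; exact: H.
Qed.

Lemma deriv_inP I f x l : deriv_in I f x l <->
  forall e, 0 < e -> exists2 d, 0 < d &
    forall y, I y -> y != x -> `|x - y| < d -> `|l - dquot f x y| < e.
Proof.
rewrite /deriv_in; split.
  by move=> /cvgrPdist_lt H e e0; apply/nbhs_within_dnbhsE; exact: H.
by move=> H; apply/cvgrPdist_lt => e e0; apply/nbhs_within_dnbhsE; exact: H.
Qed.

Lemma within_dnbhsW I x : within I x^' `=>` within I (nbhs x).
Proof.
move=> P /nbhs_withinE[d d0 H]; apply/nbhs_within_dnbhsE.
by exists d => // y Iy _; exact: H.
Qed.

Lemma cont_in_eq I f g : (forall y, I y -> f y = g y) -> cont_in I f -> cont_in I g.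
Proof.
move=> fg cf x Ix; apply/cont_at_inP => e e0.
have [d d0 H] := (cont_at_inP I f x).1 (cf x Ix) e e0.
by exists d => // y Iy xy; rewrite -!fg //; exact: H.
Qed.

Lemma deriv_in_eq I f g x l : I x -> (forall y, I y -> f y = g y) ->
  deriv_in I f x l -> deriv_in I g x l.
Proof.
move=> Ix fg /deriv_inP H; apply/deriv_inP => e /H[d d0 {}H].
by exists d => // y Iy yx xy; rewrite /dquot -!fg //; exact: H.
Qed.

Lemma cont_in_within I f : cont_in I f <-> {within I, continuous f}.
Proof. by split=> H; [apply/subspace_continuousP | move/subspace_continuousP: H]. Qed.

Lemma deriv_in_cont I f x l : deriv_in I f x l -> cont_at_in I f x.
Proof.
move=> fl; have h : (fun y => f x + dquot f x y * (y - x)) @ within I x^' --> f x + l * (x - x).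
  apply: cvgD; first exact: cvg_cst.
  apply: cvgM => //; apply: cvgB; last exact: cvg_cst.
  by move=> P xP; apply: within_dnbhsW; apply: cvg_within xP.
rewrite subrr mulr0 addr0 in h.
apply/cont_at_inP => e e0; move/cvgrPdist_lt: h => /(_ e e0) /nbhs_within_dnbhsE[d d0 H].
exists d => // y Iy xy; have [->|yx] := eqVneq y x; first by rewrite subrr normr0.
have := H y Iy yx xy; rewrite /dquot divfK ?subr_eq0 //.
by have -> : f x + (f y - f x) = f y by ring.
Qed.

Lemma deriv_in_cont_in I f f' : (forall x, I x -> deriv_in I f x (f' x)) -> cont_in I f.
Proof. by move=> ff' x /ff'; exact: deriv_in_cont. Qed.

Lemma deriv_in_cst I (c : R) x : deriv_in I (fun=> c) x 0.
Proof.
rewrite /deriv_in (_ : dquot _ _ = fun=> 0); first exact: cvg_cst.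
by apply/funext => y; rewrite /dquot subrr mul0r.
Qed.

Lemma deriv_in_id I x : deriv_in I id x 1.
Proof.
apply/deriv_inP => e e0; exists 1 => // y _ yx _.
by rewrite /dquot divff ?subr_eq0 // subrr normr0.
Qed.

Lemma deriv_inD I f g x a b : deriv_in I f x a -> deriv_in I g x b ->
  deriv_in I (fun y => f y + g y) x (a + b).
Proof.
rewrite /deriv_in => fa gb.
rewrite (_ : dquot _ _ = fun y => dquot f x y + dquot g x y); first exact: cvgD.
by apply/funext => y; rewrite /dquot -mulrDl; congr (_ / _); ring.
Qed.

Lemma deriv_inM I f g x a b : deriv_in I f x a -> deriv_in I g x b ->
  deriv_in I (fun y => f y * g y) x (a * g x + f x * b).
Proof.
rewrite /deriv_in => fa gb.
rewrite (_ : dquot _ _ = fun y => dquot f x y * g y + f x * dquot g x y); last first.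
  apply/funext => y; rewrite /dquot mulrAC mulrA -mulrDl; congr (_ / _); ring.
apply: cvgD; apply: cvgM => //; last exact: cvg_cst.
exact: cvg_trans (cvg_app _ (@within_dnbhsW I x)) (deriv_in_cont gb).
Qed.

Lemma deriv_inZ I f x a (c : R) : deriv_in I f x a ->
  deriv_in I (fun y => c * f y) x (c * a).
Proof.
move=> fa; have := deriv_inM (deriv_in_cst I c x) fa.
by rewrite mul0r add0r.
Qed.

Lemma deriv_inN I f x a : deriv_in I f x a -> deriv_in I (fun y => - f y) x (- a).
Proof.
move=> fa; have := deriv_inZ (c := -1) fa; rewrite mulN1r.
by congr deriv_in; apply/funext => y; rewrite mulN1r.
Qed.

Lemma deriv_inB I f g x a b : deriv_in I f x a -> deriv_in I g x b ->
  deriv_in I (fun y => f y - g y) x (a - b).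
Proof. by move=> fa /deriv_inN; exact: deriv_inD. Qed.

Lemma deriv_in_comp I f h x a b : is_derive (f x) 1 h b -> deriv_in I f x a ->
  deriv_in I (fun y => h (f y)) x (b * a).
Proof.
move=> /is_derive1_caratheodory[k [hk ck <-]] fa.
rewrite /deriv_in (_ : dquot _ _ = fun y => k (f y) * dquot f x y); last first.
  by apply/funext => y; rewrite /dquot hk mulrA.
apply: cvgM => //; apply: (@cvg_comp _ _ _ f k _ (nbhs (f x))) => //.
exact: cvg_trans (cvg_app _ (@within_dnbhsW I x)) (deriv_in_cont fa).
Qed.

Lemma is_derive_deriv_in I h x a : is_derive x 1 h a -> deriv_in I h x a.
Proof.
move=> ha; have := @deriv_in_comp I id h x 1 a ha (deriv_in_id _ _).
by rewrite mulr1.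
Qed.

(** A derivative relative to a neighbourhood of the point is a derivative. *)
Lemma deriv_in_is_derive I f x l : nbhs x I -> deriv_in I f x l -> is_derive x 1 f l.
Proof.
move=> /nbhs_ballP[e /= e0 xI] fl.
apply/is_derive1_caratheodory.
exists (fun y => if y == x then l else dquot f x y); split.
- move=> z; case: eqVneq => [->|zx]; first by rewrite !subrr mulr0.
  by rewrite /dquot divfK ?subr_eq0.
- apply/cvgrPdist_lt => e1 /[dup] e10 /((deriv_inP _ _ _ _).1 fl)[d d0 H]; rewrite eqxx.
  apply/nbhs_ballP; exists (Num.min d e); rewrite /= ?lt_min ?d0 ?e0 // => y.
  rewrite /ball /= lt_min => /andP[xd xe].
  case: eqVneq => [_|yx]; first by rewrite subrr normr0.
  by apply: H => //; apply: xI.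
- by rewrite eqxx.
Qed.

(** Derivatives at positive points do not see the value at 0, where solutions of
    the singular equation are at first given an arbitrary value. *)
Lemma deriv_in_eq_near0 I f g x l : 0 < x -> I x ->
  (forall y, I y -> 0 < y -> f y = g y) -> deriv_in I f x l -> deriv_in I g x l.
Proof.
move=> x0 Ix fg /deriv_inP H; apply/deriv_inP => e /H[d d0 {}H].
exists (Num.min d x); first by rewrite lt_min d0.
move=> y Iy yx; rewrite lt_min => /andP[xyd]; rewrite ltr_norml => /andP[_ y0].
by rewrite /dquot -!fg //; [exact: H|lra].
Qed.

Lemma deriv_in_sub I J f x l : J `<=` I -> deriv_in I f x l -> deriv_in J f x l.
Proof.
move=> JI /deriv_inP H; apply/deriv_inP => e /H[d d0 {}H].
by exists d => // y /JI; exact: H.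
Qed.

Lemma cont_inD I f g : cont_in I f -> cont_in I g -> cont_in I (fun y => f y + g y).
Proof. by move=> cf cg x Ix; apply: cvgD; [exact: cf|exact: cg]. Qed.

Lemma cont_inM I f g : cont_in I f -> cont_in I g -> cont_in I (fun y => f y * g y).
Proof. by move=> cf cg x Ix; apply: cvgM; [exact: cf|exact: cg]. Qed.

Lemma cont_in_cst I c : cont_in I (fun=> c).
Proof. by move=> x Ix; apply: cvg_cst. Qed.

Lemma cont_in_id I : cont_in I id.
Proof. by apply: (@deriv_in_cont_in _ _ (fun=> 1)) => x _; exact: deriv_in_id. Qed.

End RelativeDerivative.

Section Segment.
Context {R : realType}.
Implicit Types (f g : R -> R) (r x l a b : R).

Lemma segE r x : `[0, r]%classic x <-> 0 <= x <= r.
Proof. by rewrite /= in_itv /=. Qed.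

Lemma seg_nbhs r x : 0 < x < r -> nbhs x `[0, r]%classic.
Proof.
move=> /andP[x0 xr].
have : x \in `]0, r[ by rewrite in_itv /= x0.
move=> /near_in_itvoo; apply: filterS => y.
by rewrite /= !in_itv /= => /andP[/ltW -> /ltW ->].
Qed.

Lemma seg_dnbhs_proper r x : 0 < r -> 0 <= x <= r ->
  ProperFilter (within `[0, r]%classic x^').
Proof.
move=> r0 /andP[x0 xr]; apply: Build_ProperFilter_ex => P /nbhs_within_dnbhsE[d d0 H].
have [xr2|xr2] := ltP x r.
  have [m [m0 md mr]] : exists m, [/\ 0 < m, m <= d / 2 & m <= r - x].
    exists (Num.min (d / 2) (r - x)).
    by rewrite lt_min !ge_min !lexx orbT divr_gt0 //= subr_gt0 xr2; split.
  exists (x + m); apply: H.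
  - by apply/segE/andP; split; lra.
  - by rewrite gt_eqF //; lra.
  - by rewrite opprD addNKr normrN gtr0_norm //; lra.
have [m [m0 md mr]] : exists m, [/\ 0 < m, m <= d / 2 & m <= x].
  exists (Num.min (d / 2) x).
  by rewrite lt_min !ge_min !lexx orbT divr_gt0 //= (lt_le_trans r0 xr2); split.
exists (x - m); apply: H.
- by apply/segE/andP; split; lra.
- by rewrite lt_eqF //; lra.
- by rewrite subKr gtr0_norm //; lra.
Qed.

Lemma derive_in_val r f x l : 0 < r -> 0 <= x <= r ->
  deriv_in `[0, r]%classic f x l -> derive_in `[0, r]%classic f x = l.
Proof.
move=> r0 xr fl; have ? := seg_dnbhs_proper r0 xr.
exact: (cvg_lim (@Rhausdorff R)).
Qed.

Lemma cont_in_seg r f a b : 0 <= a -> b <= r -> cont_in `[0, r]%classic f ->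
  forall x, a <= x <= b -> cont_at_in `[0, r]%classic f x.
Proof. by move=> a0 br cf x /andP[ax xb]; apply/cf/segE/andP; split; lra. Qed.

Lemma deriv_in_MVT r f f' a b : 0 <= a -> a < b -> b <= r ->
  (forall x, a < x < b -> deriv_in `[0, r]%classic f x (f' x)) ->
  (forall x, a <= x <= b -> cont_at_in `[0, r]%classic f x) ->
  exists2 c, a < c < b & f b - f a = f' c * (b - a).
Proof.
move=> a0 ab br ff' cf.
have [] := @MVT R f f' a b ab.
- move=> x; rewrite in_itv /= => /andP[ax xb].
  apply: (deriv_in_is_derive (@seg_nbhs r x _)); first by apply/andP; split; lra.
  by apply: ff'; rewrite ax.
- apply/cont_in_within => y /=; rewrite in_itv /= => yab.
  move: (cf y yab); apply: cvg_trans; apply: cvg_app; apply: cvg_trans (@cvg_id _ _).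
  apply: within_subset => z; rewrite /= !in_itv /= => /andP[az zb].
  by apply/andP; split; lra.
- by move=> c; rewrite in_itv /= => cab ->; exists c.
Qed.

Lemma deriv_in_nincr r f f' a b : 0 <= a -> a <= b -> b <= r ->
  (forall x, a < x < b -> deriv_in `[0, r]%classic f x (f' x)) ->
  (forall x, a < x < b -> f' x <= 0) ->
  (forall x, a <= x <= b -> cont_at_in `[0, r]%classic f x) -> f b <= f a.
Proof.
move=> a0; rewrite le_eqVlt => /orP[/eqP -> //|ab] br ff' f'0 cf.
have [c /f'0 c0 E] := deriv_in_MVT a0 ab br ff' cf.
rewrite -subr_le0 E; apply: mulr_le0_ge0 => //; lra.
Qed.

Lemma deriv_in_lip r f f' a b C : 0 <= a -> a <= b -> b <= r ->
  (forall x, a < x < b -> deriv_in `[0, r]%classic f x (f' x)) ->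
  (forall x, a < x < b -> `|f' x| <= C) ->
  (forall x, a <= x <= b -> cont_at_in `[0, r]%classic f x) -> `|f b - f a| <= C * (b - a).
Proof.
move=> a0; rewrite le_eqVlt => /orP[/eqP -> |ab] br ff' f'0 cf.
  by rewrite !subrr mulr0 normr0.
have [c /f'0 c0 E] := deriv_in_MVT a0 ab br ff' cf.
rewrite E normrM (ger0_norm (_ : 0 <= b - a)) ?ler_wpM2r //; lra.
Qed.

Lemma cont_in_bounded r f : 0 <= r -> cont_in `[0, r]%classic f ->
  exists2 M, 0 <= M & forall x, 0 <= x <= r -> `|f x| <= M.
Proof.
move=> r0 /cont_in_within cf.
have cg : {within `[0, r], continuous (fun x => `|f x|)}.
  by move=> x; apply: continuous_comp; [exact: cf|exact: norm_continuous].
have [c _ H] := EVT_max r0 cg.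
by exists `|f c| => // x xr; apply: H; rewrite in_itv.
Qed.

(** The mean value theorem turns a limit of the derivative into a derivative
    at the end point. *)
Lemma deriv_in_at0 r f g : 0 < r -> cont_in `[0, r]%classic f ->
  (forall x, 0 < x <= r -> deriv_in `[0, r]%classic f x (g x)) ->
  cont_at_in `[0, r]%classic g 0 -> deriv_in `[0, r]%classic f 0 (g 0).
Proof.
move=> r0 cf fg /cont_at_inP cg; apply/deriv_inP => e /cg[d d0 H].
exists d => // y /segE/andP[y0 yr] yn0; rewrite sub0r normrN => yd.
have {}y0 : 0 < y by rewrite lt_neqAle eq_sym yn0.
have fg' x : 0 < x < y -> deriv_in `[0, r]%classic f x (g x).
  by move=> /andP[x0 xy]; apply: fg; rewrite x0; lra.
have [c /andP[c0 cy] E] := deriv_in_MVT (lexx 0) y0 yr fg' (cont_in_seg (lexx 0) yr cf).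
rewrite /dquot E mulfK ?subr_eq0 //; apply: H; first by apply/segE; apply/andP; split; lra.
by rewrite sub0r normrN gtr0_norm //; move: yd; rewrite gtr0_norm //; lra.
Qed.

End Segment.

(** * Functions of class C^k on a set *)

Section Ck.
Context {R : realType}.
Implicit Types (I : set R) (f g : R -> R).

Fixpoint Ck_in I k f : Prop :=
  if k is k'.+1 then
    exists2 g, (forall x, I x -> deriv_in I f x (g x)) & Ck_in I k' g
  else cont_in I f.

Lemma Ck_in_cont I k f : Ck_in I k f -> cont_in I f.
Proof. by case: k => [//|k] [g fg _]; exact: deriv_in_cont_in fg. Qed.

Lemma Ck_inW I k f : Ck_in I k.+1 f -> Ck_in I k f.
Proof.
elim: k f => [|k IH] f; first exact: Ck_in_cont.
by case=> g fg /IH; exists g.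
Qed.

Lemma Ck_in_eq I k f g : (forall x, I x -> f x = g x) -> Ck_in I k f -> Ck_in I k g.
Proof.
case: k => [|k] fg; first exact: cont_in_eq.
by case=> f' ff' Cf'; exists f' => // x Ix; exact: (deriv_in_eq Ix fg (ff' x Ix)).
Qed.

Lemma Ck_inD I k f g : Ck_in I k f -> Ck_in I k g -> Ck_in I k (fun y => f y + g y).
Proof.
elim: k f g => [|k IH] f g; first exact: cont_inD.
case=> f' ff' Cf' [g' gg' Cg']; exists (fun y => f' y + g' y); last exact: IH.
by move=> x Ix; apply: deriv_inD; [exact: ff'|exact: gg'].
Qed.

Lemma Ck_inM I k f g : Ck_in I k f -> Ck_in I k g -> Ck_in I k (fun y => f y * g y).
Proof.
elim: k f g => [|k IH] f g; first exact: cont_inM.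
move=> Cf Cg; have Cfk := Ck_inW Cf; have Cgk := Ck_inW Cg.
case: Cf Cg => f' ff' Cf' [g' gg' Cg'].
exists (fun y => f' y * g y + f y * g' y); last by apply: Ck_inD; exact: IH.
by move=> x Ix; apply: deriv_inM; [exact: ff'|exact: gg'].
Qed.

Lemma Ck_in_cst I k c : Ck_in I k (fun=> c).
Proof.
elim: k c => [|k IH] c; first exact: cont_in_cst.
by exists (fun=> 0) => // x _; exact: deriv_in_cst.
Qed.

Lemma Ck_in_id I k : Ck_in I k id.
Proof.
case: k => [|k]; first exact: cont_in_id.
by exists (fun=> 1) => [x _|]; [exact: deriv_in_id|exact: Ck_in_cst].
Qed.

Lemma Ck_inN I k f : Ck_in I k f -> Ck_in I k (fun y => - f y).
Proof.
move=> Cf; have := Ck_inM (Ck_in_cst I k (-1)) Cf.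
by apply: Ck_in_eq => x _; rewrite mulN1r.
Qed.

Lemma Ck_inB I k f g : Ck_in I k f -> Ck_in I k g -> Ck_in I k (fun y => f y - g y).
Proof. by move=> Cf /Ck_inN; exact: Ck_inD. Qed.

Lemma Ck_inX I k f m : Ck_in I k f -> Ck_in I k (fun y => f y ^+ m).
Proof.
move=> Cf; elim: m => [|m IH].
  by apply: Ck_in_eq (Ck_in_cst I k 1) => x _; rewrite expr0.
by apply: Ck_in_eq (Ck_inM Cf IH) => x _; rewrite exprS.
Qed.

(** The outer function enters with all its derivatives [h j], so that the
    chain rule closes up under induction. *)
Lemma Ck_in_comp I k f (h : nat -> R -> R) :
  (forall j x, I x -> is_derive (f x) 1 (h j) (h j.+1 (f x))) ->
  Ck_in I k f -> forall j, Ck_in I k (fun y => h j (f y)).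
Proof.
move=> hh; elim: k => [|k IH] Cf j.
  move=> x Ix; apply: (@cvg_comp _ _ _ f (h j) _ (nbhs (f x))); first exact: Cf.
  have /derivable1_diffP/differentiable_continuous : derivable (h j) (f x) 1.
    by have [] := hh j x Ix.
  by [].
have Cfk := Ck_inW Cf; case: Cf => f' ff' Cf'.
exists (fun y => h j.+1 (f y) * f' y); last by apply: Ck_inM => //; exact: IH.
by move=> x Ix; apply: deriv_in_comp; [exact: hh|exact: ff'].
Qed.

Lemma Ck_in_derive_in r k f : 0 < r -> Ck_in `[0, r]%classic k.+1 f ->
  Ck_in `[0, r]%classic k (derive_in `[0, r]%classic f).
Proof.
move=> r0 [f' ff' Cf']; apply: Ck_in_eq Cf' => x Ix.
by rewrite (derive_in_val r0 _ (ff' x Ix)) //; apply/segE.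
Qed.

Lemma Ck_in_deriv r k f x : 0 < r -> Ck_in `[0, r]%classic k.+1 f ->
  0 <= x <= r ->
  deriv_in `[0, r]%classic f x (derive_in `[0, r]%classic f x).
Proof.
move=> r0 [f' ff' _] xr; have /ff' fx : `[0, r]%classic x by exact/segE.
by rewrite (derive_in_val r0 xr fx).
Qed.

Lemma Ck_in_derive_in_n r f : 0 < r -> (forall k, Ck_in `[0, r]%classic k f) ->
  forall m k, Ck_in `[0, r]%classic k (derive_in_n `[0, r]%classic m f).
Proof.
by move=> r0 Cf; elim=> [//|m IH] k; apply: Ck_in_derive_in.
Qed.

Lemma Ck_in_smooth r f : 0 < r -> (forall k, Ck_in `[0, r]%classic k f) ->
  smooth_in `[0, r]%classic f.
Proof.
move=> r0 Cf k x /segE xr; apply/cvg_ex.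
exists (derive_in `[0, r]%classic (derive_in_n `[0, r]%classic k f) x).
exact: (Ck_in_deriv r0 (Ck_in_derive_in_n r0 Cf k 1) xr).
Qed.

Lemma smooth_in_deriv r f k x : smooth_in `[0, r]%classic f -> 0 <= x <= r ->
  deriv_in `[0, r]%classic (derive_in_n `[0, r]%classic k f) x
    (derive_in_n `[0, r]%classic k.+1 f x).
Proof. by move=> sf xr; apply: sf; exact/segE. Qed.

End Ck.

(** * Derivatives of analytic functions *)

Section Analytic.
Context {R : realType}.
Implicit Types (f : R -> R) (a : R ^nat) (x : R).

(** Compares the terms of a differentiated power series at [p] with those of the
    series itself at a larger radius [q]. *)
Lemma natmul_expr_le (p q : R) n : 0 <= p -> p <= q ->
  n.+1%:R * p ^+ n * (q - p) <= q ^+ n.+1.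
Proof.
move=> p0 pq; elim: n => [|n IH]; first by rewrite expr0 expr1; lra.
have h1 : p * (n.+1%:R * p ^+ n * (q - p)) <= p * q ^+ n.+1 by rewrite ler_wpM2l.
have h2 : p ^+ n.+1 * (q - p) <= q ^+ n.+1 * (q - p).
  by rewrite ler_wpM2r ?subr_ge0 // lerXn2r // nnegrE // (le_trans p0).
rewrite -[n.+2%:R]natr1 [q ^+ n.+2]exprS.
move: h1 h2; rewrite [p ^+ n.+1]exprS; move: (p ^+ n) (q ^+ n.+1) n.+1%:R => u v w; nra.
Qed.

Lemma is_cvg_pseries_diffs a (p q : R) : cvgn (pseries a q) -> `|p| < `|q| ->
  cvgn (pseries (pseries_diffs a) p).
Proof.
move=> Caq pq; pose t := (`|p| + `|q|) / 2.
have [pt tq] : `|p| < t /\ t < `|q| by rewrite /t; split; lra.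
have t0 : 0 < t by apply: le_lt_trans pt.
have /(is_cvg_pseries_inside_norm Caq) Ct : `|t| < `|q| by rewrite gtr0_norm.
apply: normed_cvg.
have d0 : 0 < t - `|p| by rewrite subr_gt0.
apply: (@series_le_cvg _ _ (fun n => (t - `|p|)^-1 * (`|a n.+1| * t ^+ n.+1))).
- by move=> n; exact: normr_ge0.
- by move=> n; rewrite !mulr_ge0 ?invr_ge0 ?exprn_ge0 // ltW.
- move=> n; rewrite /= /pseries_diffs !normrM normrX ger0_norm ?ler0n //.
  rewrite ler_pdivlMl //.
  have := natmul_expr_le n (normr_ge0 p) (ltW pt).
  have := normr_ge0 (a n.+1).
  by move: (`|a _|) n.+1%:R (`|p| ^+ n) (t ^+ _) => u v w z u0 h; nra.
- have Cs : cvgn (series (fun n => `|a n.+1| * t ^+ n.+1)).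
    pose u n := `|a n| * t ^+ n.
    have -> : series (fun n => u n.+1) = (fun n => series u n.+1 - u 0%N).
      by apply/funext => n; rewrite /series /= [in RHS]big_nat_recl //= addrC addKr.
    apply: is_cvgB; last exact: is_cvg_cst.
    by move/cvg_ex: Ct => [l Hl]; apply/cvg_ex; exists l; rewrite cvg_shiftS.
  exact: is_cvg_seriesZ.
Qed.

(** The power series may be differentiated term by term on its whole disc: at a
    given point, all three series involved converge at a slightly larger
    radius. *)
Lemma analytic_at_derive f x : analytic_at f x ->
  exists (a : R ^nat) r, [/\ 0 < r,
    forall y, `|y - x| < r -> is_derive y 1 f (limn (pseries (pseries_diffs a) (y - x)))
  & forall y, `|y - x| < r -> cvgn (pseries (pseries_diffs a) (y - x))].
Proof.
case=> a [r [r0 fa]]; exists a, r.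
have cvga t : 0 <= t -> t < r -> cvgn (pseries a t).
  move=> t0 tr; apply/cvg_ex; exists (f (x + t)).
  have := fa (x + t); rewrite addrC addKr ger0_norm //; exact.
have cvgd t : `|t| < r -> cvgn (pseries (pseries_diffs a) t).
  move=> tr; apply: (@is_cvg_pseries_diffs _ _ ((`|t| + r) / 2)).
    by apply: cvga; have := normr_ge0 t; lra.
  rewrite (ger0_norm (_ : 0 <= (`|t| + r) / 2)); have := normr_ge0 t; lra.
have cvgdd t : `|t| < r -> cvgn (pseries (pseries_diffs (pseries_diffs a)) t).
  move=> tr; apply: (@is_cvg_pseries_diffs _ _ ((`|t| + r) / 2)).
    apply: cvgd; rewrite (ger0_norm (_ : 0 <= (`|t| + r) / 2)); have := normr_ge0 t; lra.
  rewrite (ger0_norm (_ : 0 <= (`|t| + r) / 2)); have := normr_ge0 t; lra.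
split=> // y yr; last exact: cvgd.
have K0 : 0 <= (`|y - x| + r) / 2 by have := normr_ge0 (y - x); lra.
have Kr : `|(`|y - x| + r) / 2| < r by rewrite (ger0_norm K0); lra.
have yK : `|y - x| < `|(`|y - x| + r) / 2| by rewrite (ger0_norm K0); lra.
have D : is_derive (y - x) (1 : R) (fun z => limn (pseries a z))
    (limn (pseries (pseries_diffs a) (y - x))).
  apply: (pseries_snd_diffs _ _ _ yK); [|exact: cvgd|exact: cvgdd].
  by apply: cvga => //; rewrite (ger0_norm K0) in Kr.
have Dx : is_derive y (1 : R) (fun z => z - x) 1.
  by apply: is_derive_eq; rewrite subr0.
have := @is_derive1_comp _ (fun z => limn (pseries a z)) (fun z => z - x) y _ _ D Dx.
rewrite mulr1; apply: near_eq_is_derive.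
near=> z; rewrite /=; apply/cvg_lim => //; apply: fa; near: z.
apply/nbhs_ballP; exists (r - `|y - x|); first by rewrite /= subr_gt0.
move=> z; rewrite /ball /= => zy.
have -> : z - x = (y - x) - (y - z) by ring.
by apply: le_lt_trans (ler_normB _ _) _; lra.
Unshelve. all: by end_near.
Qed.

Lemma analytic_at_is_derive f x : analytic_at f x -> is_derive x 1 f (derive1 f x).
Proof.
move=> /analytic_at_derive[a [r [r0 fa _]]].
have xx : `|x - x| < r by rewrite subrr normr0.
by have [dx _] := fa x xx; rewrite derive1E; apply: derivableP.
Qed.

Lemma analytic_at_derive1 f x : analytic_at f x -> analytic_at (derive1 f) x.
Proof.
move=> /analytic_at_derive[a [r [r0 fa ca]]]; exists (pseries_diffs a), r; split=> // y yr.
have fy := fa y yr; rewrite derive1E (derive_val (is_derive := fy)).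
exact: ca.
Qed.

Lemma analytic_at_derive1n f k x : analytic_at f x -> analytic_at (derive1n k f) x.
Proof.
by move=> fx; elim: k => [//|k IH]; rewrite derive1nS; apply: analytic_at_derive1.
Qed.

Lemma analytic_at_is_derive1n f k x : analytic_at f x ->
  is_derive x 1 (derive1n k f) (derive1n k.+1 f x).
Proof.
by move=> fx; rewrite derive1nS; apply/analytic_at_is_derive/analytic_at_derive1n.
Qed.

End Analytic.

(** * The linear equation 4 s^2 y' + (1 + s b) y = f *)

Section Singular.
Context {R : realType}.
Implicit Types (f y b : R -> R) (r s c : R).

(** [exp (- c / s)] is flat at 0; the fifth power is enough to beat the squares of
    functions of size [O(s^-2)]. *)
Lemma expR_decay c s : 0 < c -> 0 < s -> expR (- (c / s)) <= (5 / c) ^+ 5 * s ^+ 5.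
Proof.
move=> c0 s0; have x0 : 0 < c / s by rewrite divr_gt0.
have x5 : 0 < c / s / 5 by rewrite divr_gt0.
have h : (c / s / 5) ^+ 5 <= expR (c / s).
  have -> : c / s = 5%:R * (c / s / 5) by field; rewrite gt_eqF.
  rewrite expRM_natl mulrAC divff // mul1r lerXn2r // ?nnegrE ?expR_ge0 ?ltW //.
  by have := expR_ge1Dx (c / s / 5); lra.
rewrite expRN -exprMn (_ : 5 / c * s = (c / s / 5)^-1); last first.
  by field; rewrite !gt_eqF.
by rewrite exprVn lef_pV2 // posrE ?expR_gt0 // exprn_gt0.
Qed.

Lemma is_derive_expR_pole c s : 0 < s ->
  is_derive s (1 : R) (fun t => expR (- (c / t))) (expR (- (c / s)) * (c / s ^+ 2)).
Proof.
move=> s0; have s1 : s != 0 by rewrite gt_eqF.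
have D : is_derive s (1 : R) (fun t => - (c / t)) (c / s ^+ 2).
  have DV : is_derive s (1 : R) (fun t : R => t^-1) (- (s ^- 2)).
    apply: is_derive_eq; first by apply: is_deriveV.
    by rewrite scaler1.
  apply: is_derive_eq; rewrite /GRing.scale /=; field.
  by [].
exact: (@is_derive1_comp _ expR (fun t => - (c / t))).
Qed.

Lemma deriv_in_inv_4sqr (I : set R) s : 0 < s ->
  deriv_in I (fun t => (4 * t ^+ 2)^-1) s (- (8 * s / (4 * s ^+ 2) ^+ 2)).
Proof.
move=> s0; apply: is_derive_deriv_in.
have sn0 : 4 * s ^+ 2 != 0 by rewrite mulf_neq0 // expf_neq0 // gt_eqF.
have D : is_derive s (1 : R) (fun x : R => 4 * x ^+ 2) (8 * s).
  by apply: is_derive_eq; rewrite /GRing.scale /=; ring.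
apply: (is_derive_eq (@is_deriveV R (fun x => 4 * x ^+ 2) s _ 1 sn0 D)).
by rewrite /GRing.scale /=; field; rewrite gt_eqF.
Qed.

(** Maximum principle.  For [q = y^2 - M^2] the equation gives
    [4 s^2 q' <= - alpha q], so [q exp (- alpha / (4 s))] is nonincreasing; it
    tends to 0 at the singular point because [y] is of size [O(s^-2)]
    there, hence it is never positive. *)
Lemma singular_max_principle r alpha M C a f y y' :
  0 < alpha -> 0 <= M ->
  (forall s, 0 < s <= r -> deriv_in `[0, r]%classic y s (y' s)) ->
  (forall s, 0 < s <= r -> 4 * s ^+ 2 * y' s + a s * y s = f s) ->
  (forall s, 0 < s <= r -> alpha <= a s) ->
  (forall s, 0 < s <= r -> `|f s| <= alpha * M) ->
  (forall s, 0 < s <= r -> s ^+ 2 * `|y s| <= C) ->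
  forall s, 0 < s <= r -> `|y s| <= M.
Proof.
move=> al0 M0 yD eq aal fM yC s /andP[s0 sr].
pose E t := expR (- (alpha / 4 / t)).
have E0 t : 0 < E t by exact: expR_gt0.
pose g t := (y t ^+ 2 - M ^+ 2) * E t.
have gD t : 0 < t <= r -> deriv_in `[0, r]%classic g t
    ((y' t * y t + y t * y' t + - 0) * E t
     + (y t ^+ 2 - M ^+ 2) * (E t * (alpha / 4 / t ^+ 2))).
  move=> tr; apply: deriv_inM.
    apply: deriv_inD; first exact: deriv_inM (yD _ tr) (yD _ tr).
    by apply: deriv_inN; exact: deriv_in_cst.
  by apply/is_derive_deriv_in/is_derive_expR_pole; case/andP: tr.
have gnincr t : 0 < t -> t <= s -> g s <= g t.
  move=> t0 ts.
  have tsr x : t <= x <= s -> 0 < x <= r.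
    by case/andP=> tx xs; apply/andP; split; lra.
  apply: (deriv_in_nincr (ltW t0) ts sr).
  - by move=> x /andP[tx xs]; apply: gD; apply: tsr; rewrite !ltW.
  - move=> x /andP[tx xs]; have x0 : 0 < x by lra.
    have xr : 0 < x <= r by rewrite x0; lra.
    have := eq x xr; have := aal x xr; have := fM x xr; rewrite ler_norml.
    have x2 : 0 < x ^+ 2 by rewrite exprn_gt0.
    rewrite -(pmulr_rle0 _ (mulr_gt0 (ltr0Sn _ 3) x2)).
    have -> : 4 * x ^+ 2 * ((y' x * y x + y x * y' x + - 0) * E x
       + (y x ^+ 2 - M ^+ 2) * (E x * (alpha / 4 / x ^+ 2))) =
       E x * (2 * y x * (4 * x ^+ 2 * y' x) + alpha * (y x ^+ 2 - M ^+ 2)).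
      by field; rewrite gt_eqF.
    rewrite (pmulr_rle0 _ (E0 x)) => /andP[f1 f2] ha h.
    have -> : 4 * x ^+ 2 * y' x = f x - a x * y x by rewrite -h; ring.
    have y2 := sqr_ge0 (y x).
    have h2 : alpha * y x ^+ 2 <= a x * y x ^+ 2 by rewrite ler_wpM2r.
    have h3 : 2 * y x * f x <= alpha * (M ^+ 2 + y x ^+ 2).
      have := sqr_ge0 (M - y x); have := sqr_ge0 (M + y x).
      by have [y0|y0] := leP 0 (y x); nra.
    nra.
  - by move=> x /tsr /gD; exact: deriv_in_cont.
have gle t : 0 < t -> t <= s -> g s <= (C ^+ 2 * (5 / (alpha / 4)) ^+ 5) * t.
  move=> t0 ts; apply: (le_trans (gnincr t t0 ts)).
  have trr : 0 < t <= r by rewrite t0; lra.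
  have C0 : 0 <= C by apply: le_trans (yC t trr); exact: mulr_ge0 (sqr_ge0 _) (normr_ge0 _).
  have t4 : 0 < t ^+ 4 by rewrite exprn_gt0.
  have ty0 : 0 <= t ^+ 2 * `|y t| by exact: mulr_ge0 (sqr_ge0 _) (normr_ge0 _).
  have := yC t trr; rewrite -(@ler_pXn2r _ 2) // => h.
  have {}h : t ^+ 4 * y t ^+ 2 <= C ^+ 2.
    by move: h; rewrite exprMn -exprM real_normK ?num_real.
  have al4 : 0 < alpha / 4 by rewrite divr_gt0.
  have hE := expR_decay al4 t0.
  rewrite -/(E t) in hE.
  have K0 : 0 <= (5 / (alpha / 4)) ^+ 5 by rewrite exprn_ge0 // ltW // divr_gt0.
  rewrite /g; apply: (@le_trans _ _ (y t ^+ 2 * ((5 / (alpha / 4)) ^+ 5 * t ^+ 5))).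
    apply: (@le_trans _ _ (y t ^+ 2 * E t)).
      by rewrite ler_pM2r //; have := sqr_ge0 M; lra.
    by rewrite ler_wpM2l ?sqr_ge0.
  rewrite (_ : t ^+ 5 = t ^+ 4 * t); last by rewrite [in LHS]exprSr.
  move: h K0; move: (_ ^+ 5) (t ^+ 4) (y t ^+ 2) (C ^+ 2) => k u v w h k0.
  have -> : v * (k * (u * t)) = (u * v) * (k * t) by ring.
  have -> : w * k * t = w * (k * t) by ring.
  by rewrite ler_wpM2r // mulr_ge0 // ltW.
have gs0 : g s <= 0.
  rewrite leNgt; apply/negP => gs.
  set K := C ^+ 2 * _ in gle.
  have K0 : 0 < K.
    by have := gle s s0 (lexx _) => h; rewrite -(pmulr_lgt0 _ s0); exact: lt_le_trans h.
  have t0 : 0 < Num.min s (g s / (2 * K)) by rewrite lt_min s0 divr_gt0 // mulr_gt0.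
  have := gle _ t0; rewrite ge_min lexx => /(_ isT); rewrite leNgt => /negP; apply.
  apply: (@le_lt_trans _ _ (K * (g s / (2 * K)))).
    by rewrite ler_pM2l // ge_min lexx orbT.
  have -> : K * (g s / (2 * K)) = g s / 2 by field; rewrite gt_eqF.
  lra.
move: gs0; rewrite /g (pmulr_lle0 _ (E0 s)) subr_le0 => h.
by rewrite -(@ler_pXn2r _ 2) ?nnegrE // real_normK ?num_real.
Qed.

(** A solution of size [O(s^-2)] tends to the value that the
    equation prescribes at the singular point: the maximum principle applies to
    the difference with that value, on shorter and shorter intervals. *)
Lemma singular_cont0 r B C b f y y' : 0 < r ->
  (forall s, 0 < s <= r -> `|b s| <= B) ->
  cont_at_in `[0, r]%classic f 0 -> y 0 = f 0 ->
  (forall s, 0 < s <= r -> deriv_in `[0, r]%classic y s (y' s)) ->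
  (forall s, 0 < s <= r -> 4 * s ^+ 2 * y' s + (1 + s * b s) * y s = f s) ->
  (forall s, 0 < s <= r -> s ^+ 2 * `|y s| <= C) ->
  cont_at_in `[0, r]%classic y 0.
Proof.
move=> r0 bB cf y0 yD eq yC; apply/cont_at_inP => e e0; rewrite y0.
set L := f 0; have L0 := normr_ge0 L.
have B0 : 0 <= B.
  by have := bB r; rewrite r0 lexx => /(_ isT); apply: le_trans; exact: normr_ge0.
have e8 : 0 < e / 8 by rewrite divr_gt0.
have [d d0 fL] := (cont_at_inP _ _ _).1 cf _ e8.
(* On [0, q] the coefficient [1 + s b] is at least 1/2, and the right side of the
   equation for [y - L] is at most half of [e / 2]. *)
have [q [q0 qr qd qB qL]] : exists q,
    [/\ 0 < q, q <= r, q < d, q * B <= 1 / 2 & q * (B * `|L|) <= e / 8].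
  have B1 : 0 < B + 1 by lra.
  have BL1 : 0 < B * `|L| + 1 by have := mulr_ge0 B0 L0; lra.
  have aux (c X : R) : 0 <= c -> 0 <= X -> c / (X + 1) * X <= c.
    by move=> c0 X0; rewrite mulrAC ler_pdivrMr; [nra|lra].
  exists (Num.min (Num.min r (d / 2)) (Num.min (1 / 2 / (B + 1)) (e / 8 / (B * `|L| + 1)))).
  split.
  - by rewrite !lt_min r0 !divr_gt0.
  - by rewrite !ge_min lexx.
  - by rewrite !gt_min (_ : d / 2 < d) ?orbT //; lra.
  - apply: (@le_trans _ _ (1 / 2 / (B + 1) * B)).
      by rewrite ler_wpM2r // !ge_min lexx !orbT.
    by apply: aux => //; lra.
  - apply: (@le_trans _ _ (e / 8 / (B * `|L| + 1) * (B * `|L|))).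
      by rewrite ler_wpM2r ?mulr_ge0 // !ge_min lexx !orbT.
    by apply: aux => //; [lra|exact: mulr_ge0].
have qsub s : 0 < s <= q -> 0 < s <= r by case/andP=> -> /= sq; lra.
have MP : forall s, 0 < s <= q -> `|y s - L| <= e / 2.
  apply: (@singular_max_principle q (1 / 2) (e / 2) (C + r ^+ 2 * `|L|)
    (fun s => 1 + s * b s) (fun s => f s - L - s * b s * L) (fun s => y s - L) y').
  - lra.
  - lra.
  - move=> s /qsub sr; rewrite -[y' s]subr0; apply: deriv_inB; last exact: deriv_in_cst.
    apply: deriv_in_sub (yD s sr) => x; rewrite /= !in_itv /= => /andP[-> xq] /=; lra.
  - by move=> s /qsub sr; rewrite -eq //; ring.
  - move=> s sq; have := bB s (qsub s sq); rewrite ler_norml => /andP[h1 _].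
    case/andP: sq => s0 sq.
    have : s * B <= q * B by rewrite ler_wpM2r.
    nra.
  - move=> s sq; have := bB s (qsub s sq) => hb; case/andP: (sq) => s0 s1.
    have hf : `|f s - L| <= e / 8.
      rewrite distrC ltW // fL //; last by rewrite sub0r normrN gtr0_norm //; lra.
      by case/andP: (qsub s sq) => _ sr; apply/segE; rewrite sr ltW.
    have hs : `|s * b s * L| <= e / 8.
      have h1 : `|b s| * `|L| <= B * `|L| by rewrite ler_wpM2r.
      apply: le_trans qL; rewrite !normrM (gtr0_norm s0) -mulrA.
      exact: (ler_pM (ltW s0) (mulr_ge0 (normr_ge0 _) (normr_ge0 _)) s1 h1).
    by apply: le_trans (ler_normB _ _) _; lra.
  - move=> s /qsub sr; have := yC s sr; case/andP: sr => s0 sr h.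
    have s2 := sqr_ge0 s.
    have h2 : s ^+ 2 * `|L| <= r ^+ 2 * `|L|.
      by rewrite ler_wpM2r // lerXn2r // nnegrE ltW.
    have : s ^+ 2 * `|y s - L| <= s ^+ 2 * (`|y s| + `|L|).
      by rewrite ler_wpM2l // ler_normB.
    by rewrite mulrDr; lra.
exists q => // x /segE /andP[x0 xr]; rewrite sub0r normrN distrC.
have [<-|xn0] := eqVneq 0 x; first by rewrite y0 subrr normr0.
have {}x0 : 0 < x by rewrite lt_neqAle xn0.
rewrite gtr0_norm // => xq; apply: (@le_lt_trans _ _ (e / 2)); last by lra.
by apply: MP; rewrite x0 ltW.
Qed.

(** Regularity up to the singular point.  The derivative [z'] solves an
    equation of the same kind, with [b] replaced by [b + 8], and is of size
    [O(s^-2)]; so one order of differentiability is gained at each step. *)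
Lemma singular_Ck k r C b f z z' : 0 < r ->
  Ck_in `[0, r]%classic k b -> Ck_in `[0, r]%classic k f -> z 0 = f 0 ->
  (forall s, 0 < s <= r -> deriv_in `[0, r]%classic z s (z' s)) ->
  (forall s, 0 < s <= r -> 4 * s ^+ 2 * z' s + (1 + s * b s) * z s = f s) ->
  (forall s, 0 < s <= r -> s ^+ 2 * `|z s| <= C) ->
  Ck_in `[0, r]%classic k z.
Proof.
move=> r0; elim: k C b f z z' => [|k IH] C b f z z' Cb Cf z0 zD eq zC.
  have [B B0 bB] := cont_in_bounded (ltW r0) Cb.
  move=> s /segE /andP[s0 sr]; have [s00|sn0] := eqVneq s 0.
    rewrite s00; apply: (@singular_cont0 r B C b f z z') => //.
    - by move=> t /andP[t0 tr]; apply: bB; rewrite ltW.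
    - by apply: Cf; apply/segE; rewrite lexx ltW.
  by apply: (deriv_in_cont (zD s _)); rewrite sr lt_neqAle eq_sym sn0 s0.
have Czk : Ck_in `[0, r]%classic k z.
  by apply: (IH C b f z z') => //; exact: Ck_inW.
have cz := Ck_in_cont Czk.
have Cbk := Ck_inW Cb.
have cb := Ck_in_cont Cb; have cf := Ck_in_cont Cf.
case: Cb Cf => b' bb' Cb' [f' ff' Cf'].
(* At 0, [w] takes the value that its own equation prescribes there. *)
pose w s := if s == 0 then f' 0 - (b 0 + 0 * b' 0) * z 0 else z' s.
have wE s : 0 < s -> w s = z' s by move=> s0; rewrite /w gt_eqF.
have z'E s : 0 < s <= r -> z' s = (f s - (1 + s * b s) * z s) * (4 * s ^+ 2)^-1.
  move=> /[dup] sr /andP[s0 _]; rewrite -eq //; field; by rewrite gt_eqF.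
have Cw : Ck_in `[0, r]%classic k w.
  pose h' s := f' s - ((0 + (1 * b s + s * b' s)) * z s + (1 + s * b s) * z' s).
  pose w' s := h' s * (4 * s ^+ 2)^-1
    + (f s - (1 + s * b s) * z s) * (- (8 * s / (4 * s ^+ 2) ^+ 2)).
  have cq : cont_in `[0, r]%classic (fun s => f s - (1 + s * b s) * z s).
    apply: cont_inD => //; have : Ck_in `[0, r]%classic 0 (fun s => (1 + s * b s) * z s).
      apply: Ck_inM => //; apply: Ck_inD; first exact: Ck_in_cst.
      by apply: Ck_inM => //; exact: Ck_in_id.
    by move/Ck_inN.
  have [K K0 hK] := cont_in_bounded (ltW r0) cq.
  apply: (IH (K / 4) (fun s => b s + 8) (fun s => f' s - (b s + s * b' s) * z s) w w').
  - by apply: Ck_inD => //; exact: Ck_in_cst.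
  - apply: Ck_inB => //; apply: Ck_inM => //; apply: Ck_inD => //.
    by apply: Ck_inM => //; exact: Ck_in_id.
  - by rewrite /w eqxx.
  - move=> s /[dup] sr /andP[s0 s1].
    have sI : `[0, r]%classic s by apply/segE; rewrite ltW.
    apply: (@deriv_in_eq_near0 _ _
      (fun s => (f s - (1 + s * b s) * z s) * (4 * s ^+ 2)^-1)) => //.
      by move=> t /segE/andP[_ tr] t0; rewrite wE // z'E // t0.
    apply: deriv_inM.
      apply: deriv_inB; first exact: ff'.
      apply: deriv_inM; last exact: zD.
      apply: deriv_inD; first exact: deriv_in_cst.
      by apply: deriv_inM; [exact: deriv_in_id|exact: bb'].
    exact: deriv_in_inv_4sqr.
  - move=> s /[dup] sr /andP[s0 s1]; rewrite wE // /w' /h'.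
    have -> : f s - (1 + s * b s) * z s = z' s * (4 * s ^+ 2).
      by rewrite -eq //; ring.
    by field; rewrite gt_eqF.
  - move=> s /[dup] sr /andP[s0 s1]; rewrite wE // z'E // normrM.
    have s2 : 0 < s ^+ 2 by rewrite exprn_gt0.
    rewrite (@gtr0_norm _ (_^-1)); last by rewrite invr_gt0 mulr_gt0.
    rewrite (_ : s ^+ 2 * _ = `|f s - (1 + s * b s) * z s| / 4); last by field; rewrite gt_eqF.
    by rewrite ler_wpM2r // hK // s1 ltW.
exists w => // s /segE/andP[s0 sr]; have [->|sn0] := eqVneq s 0.
  apply: deriv_in_at0 => //.
    by move=> t /[dup] tr /andP[t0 _]; rewrite wE //; exact: zD.
  by apply: (Ck_in_cont Cw); apply/segE; rewrite lexx ltW.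
have {}s0 : 0 < s by rewrite lt_neqAle eq_sym sn0.
by rewrite wE //; apply: zD; rewrite s0.
Qed.

End Singular.

(** * Solving the linear equation *)

Section Antiderivative.
Context {R : realType}.
Implicit Types (f y : R -> R) (r s M : R).

Lemma continuous_antiderivative f (a u : R) : a < u -> continuous f ->
  exists F : R -> R, forall x, a < x < u -> is_derive x 1 F (f x).
Proof.
move=> au cf.
exists (fun x => \int[lebesgue_measure]_(t in [set` Interval (BLeft a) (BRight x)]) f t).
move=> x /andP[ax xu].
have intf : lebesgue_measure.-integrable [set` Interval (BLeft a) (BRight u)] (EFin \o f).
  apply: continuous_compact_integrable; first exact: segment_compact.
  exact: continuous_subspaceT.
have [] := @continuous_FTC1 R f (BLeft a) x u xu intf ax (cf x).
by move=> D <-; rewrite derive1E; exact: derivableP.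
Qed.

(** The integration theory of continuous functions is for functions on the whole
    line; composing with the nearest-point projection, which is 1-Lipschitz,
    extends a function given on [0, r] with the same values. *)
Lemma cont_in_extend r f : 0 <= r -> cont_in `[0, r]%classic f ->
  exists F : R -> R, [/\ continuous F, forall s, 0 <= s <= r -> F s = f s
    & forall s, exists2 t, 0 <= t <= r & F s = f t].
Proof.
move=> r0 cf; pose c s := Num.max 0 (Num.min s r).
have c_in s : 0 <= c s <= r by rewrite /c le_max lexx ge_max r0 ge_min lexx orbT.
exists (fun s => f (c s)); split.
- move=> s; apply/cvgrPdist_lt => e e0.
  have [d d0 H] := (cont_at_inP _ _ _).1 (cf (c s) ((segE _ _).2 (c_in s))) e e0.
  apply/nbhs_ballP; exists d => // t; rewrite /ball /= => st.
  apply: H; first exact/segE.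
  apply: le_lt_trans st; rewrite /c.
  have lip_min (a b : R) : `|Num.min a r - Num.min b r| <= `|a - b|.
    rewrite !minr_absE; have := ler_dist_dist (a - r) (b - r).
    have -> : a - r - (b - r) = a - b by ring.
    by rewrite !ler_norml => /andP[h1 h2]; have := ler_norm (a - b); have := ler_norm (b - a);
      rewrite (distrC b a) => h3 h4; apply/andP; split; lra.
  have lip_max (a b : R) : `|Num.max 0 a - Num.max 0 b| <= `|a - b|.
    rewrite !maxr_absE !sub0r !normrN; have := ler_dist_dist a b.
    by rewrite !ler_norml => /andP[h1 h2]; have := ler_norm (a - b); have := ler_norm (b - a);
      rewrite (distrC b a) => h3 h4; apply/andP; split; lra.
  exact: le_trans (lip_max _ _) (lip_min _ _).
- by move=> s /andP[s0 sr]; rewrite /c (min_idPl sr) (max_idPr s0).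
- by move=> s; exists (c s).
Qed.

Lemma antiderivative_in r f : 0 < r -> cont_in `[0, r]%classic f ->
  exists F : R -> R, F 0 = 0 /\
    forall s, 0 <= s <= r -> deriv_in `[0, r]%classic F s (f s).
Proof.
move=> r0 /(cont_in_extend (ltW r0))[g [cg gf _]].
have [|F FD] := @continuous_antiderivative g (-1) (r + 1) _ cg; first by lra.
exists (fun s => F s - F 0); split=> [|s sr]; first by rewrite subrr.
rewrite -[f s]subr0; apply: deriv_inB; last exact: deriv_in_cst.
by apply: is_derive_deriv_in; rewrite -gf //; apply: FD; case/andP: sr; lra.
Qed.

(** The equation [4 s^2 y' + y = f] has a bounded solution: the primitive
    vanishing at 0 of the derivative of [y exp (- 1 / (4 s))], times
    [exp (1 / (4 s))]. *)
Lemma singular_solve r M f : 0 < r -> 0 <= M ->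
  cont_in `[0, r]%classic f -> (forall s, 0 <= s <= r -> `|f s| <= M) ->
  exists y : R -> R, [/\ y 0 = f 0, cont_in `[0, r]%classic y &
    forall s, 0 < s <= r ->
      `|y s| <= M /\ deriv_in `[0, r]%classic y s ((f s - y s) / (4 * s ^+ 2))].
Proof.
move=> r0 M0 cf0 fM0.
have [f1 [cf f1f f1ex]] := cont_in_extend (ltW r0) cf0.
have fM s : `|f1 s| <= M by have [t tr ->] := f1ex s; exact: fM0.
pose E s := expR (- (4^-1 / s)) : R.
have E0 s : 0 < E s by exact: expR_gt0.
pose E' s := E s * (4^-1 / s ^+ 2).
have ED s : 0 < s -> is_derive s (1 : R) E (E' s) by exact: is_derive_expR_pole.
pose F s := if 0 < s then E' s * f1 s else 0.
have E'0 s : 0 < s -> 0 < E' s.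
  by move=> s0; rewrite mulr_gt0 // divr_gt0 // exprn_gt0.
have cF : continuous F.
  suff : forall s : R, F @ s --> F s by [].
  move=> s; have [s0|s0|s0] := ltgtP s 0.
  - apply: (@cvg_trans _ ((fun=> 0 : R) @ s)); last first.
      have -> : F s = 0 by rewrite /F ltNge (ltW s0).
      by move=> P /nbhs_singleton P0; apply: (@filterE _ (nbhs s)) => x.
    apply: near_eq_cvg; have : \forall t \near s, t < 0 by exact: lt_nbhsl.
    by apply: filterS => t t0; rewrite /F ltNge (ltW t0).
  - apply: (@cvg_trans _ ((fun t => E' t * f1 t) @ s)).
      apply: near_eq_cvg; have : \forall t \near s, - t < 0 by apply: Nlt_nbhsl; rewrite oppr_lt0.
      by apply: filterS => t; rewrite oppr_lt0 /F => ->.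
    have -> : F s = E' s * f1 s by rewrite /F s0.
    have cE : E @ s --> E s.
      have /derivable1_diffP/differentiable_continuous : derivable E s 1 by have [] := ED s s0.
      by [].
    have cV : (fun t : R => (t ^+ 2)^-1) @ s --> (s ^+ 2)^-1.
      apply: (@cvgV _ _ _ _ (fun t : R => t ^+ 2)); first by rewrite expf_neq0 // gt_eqF.
      exact: exprn_continuous.
    have cEf := (cvgM (cvgM cE (cvgM (cvg_cst (4^-1 : R)) cV)) (cf s)).
    exact: cEf.
  - rewrite s0 /F ltxx; apply/cvgrPdist_lt => e e0.
    pose K := (5 / 4^-1) ^+ 5 * (M + 1) : R.
    have K0 : 0 < K by rewrite mulr_gt0 ?exprn_gt0 ?divr_gt0 ?invr_gt0 //; lra.
    apply/nbhs_ballP; exists (Num.min 1 (e / K)); first by rewrite /= lt_min ltr01 divr_gt0.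
    move=> t; rewrite /ball /= sub0r normrN lt_min => /andP[t1 te].
    case: ifPn => [t0|_]; last by rewrite subrr normr0.
    rewrite sub0r normrN normrM (gtr0_norm (E'0 t t0)).
    have q4 : 0 < (4^-1 : R) by rewrite invr_gt0.
    have hE := expR_decay q4 t0.
    rewrite -/(E t) in hE; rewrite (gtr0_norm t0) in t1 te.
    have h1 : E' t <= (5 / 4^-1) ^+ 5 * t.
      rewrite /E' mulrA ler_pdivrMr ?exprn_gt0 //.
      have : (5 / 4^-1) ^+ 5 * t ^+ 5 <= (5 / 4^-1) ^+ 5 * (t * t ^+ 2).
        rewrite ler_wpM2l ?exprn_ge0 ?divr_ge0 ?invr_ge0 // -exprS.
        by rewrite ler_wiXn2l // ltW.
      by rewrite mulrA; have := E0 t; lra.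
    apply: (@le_lt_trans _ _ (((5 / 4^-1) ^+ 5 * t) * (M + 1))).
      apply: ler_pM => //; first exact/ltW/E'0.
      by have := fM t; lra.
    by rewrite mulrAC -/K mulrC -ltr_pdivlMr.
have [|G GD] := @continuous_antiderivative F (-1) (r + 1) _ cF; first by lra.
have GDr s : 0 <= s <= r -> deriv_in `[0, r]%classic G s (F s).
  by move=> sr; apply/is_derive_deriv_in/GD; case/andP: sr; lra.
have cG : cont_in `[0, r]%classic G.
  by apply: (@deriv_in_cont_in _ _ _ F) => s /segE; exact: GDr.
have GE s : 0 < s <= r -> `|G s - G 0| <= M * E s.
  move=> /andP[s0 sr]; apply/ler_addgt0Pr => e e0.
  have I0 : `[0, r]%classic (0 : R) by apply/segE; rewrite lexx ltW.
  have [d d0 H] := (cont_at_inP _ _ _).1 (cG 0 I0) e e0.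
  pose t := Num.min (d / 2) s.
  have t0 : 0 < t by rewrite lt_min divr_gt0.
  have ts : t <= s by rewrite ge_min lexx orbT.
  have td : t < d by rewrite gt_min (_ : d / 2 < d) //; lra.
  have hG : `|G 0 - G t| < e.
    apply: H; first by apply/segE; rewrite ltW //=; lra.
    by rewrite sub0r normrN gtr0_norm.
  have EDr x : t <= x <= s -> deriv_in `[0, r]%classic (fun x => M * E x) x (M * E' x).
    move=> /andP[tx _]; apply: deriv_inZ; apply/is_derive_deriv_in/ED; lra.
  have GDx x : t <= x <= s -> deriv_in `[0, r]%classic G x (F x).
    by move=> /andP[tx xs]; apply: GDr; apply/andP; split; lra.
  have FE x : t <= x <= s -> - (M * E' x) <= F x <= M * E' x.
    move=> /andP[tx xs]; have x0 : 0 < x by lra.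
    have := fM x; rewrite ler_norml /F x0 => /andP[h1 h2]; have := E'0 x x0.
    by move=> h3; apply/andP; split; nra.
  have up : G s - M * E s <= G t - M * E t.
    apply: (deriv_in_nincr (f := fun x => G x - M * E x) (f' := fun x => F x - M * E' x) (ltW t0) ts sr).
    - by move=> x /andP[/ltW tx /ltW xs]; apply: deriv_inB; [apply: GDx|apply: EDr]; rewrite tx.
    - move=> x /andP[/ltW tx /ltW xs]; have := FE x; rewrite tx xs => /(_ isT)/andP[_ h]; lra.
    - move=> x txs; exact: deriv_in_cont (deriv_inB (GDx x txs) (EDr x txs)).
  have dn : - G s - M * E s <= - G t - M * E t.
    apply: (deriv_in_nincr (f := fun x => - G x - M * E x) (f' := fun x => - F x - M * E' x) (ltW t0) ts sr).
    - by move=> x /andP[/ltW tx /ltW xs]; apply: deriv_inB;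
        [apply: deriv_inN; apply: GDx|apply: EDr]; rewrite tx.
    - move=> x /andP[/ltW tx /ltW xs]; have := FE x; rewrite tx xs => /(_ isT)/andP[h _]; lra.
    - move=> x txs; exact: deriv_in_cont (deriv_inB (deriv_inN (GDx x txs)) (EDr x txs)).
  have ME : 0 <= M * E t by rewrite mulr_ge0 // ltW.
  by move: hG; rewrite ltr_norml ler_norml => /andP[h1 h2]; apply/andP; split; lra.
pose y s := if s == 0 then f 0 else (E s)^-1 * (G s - G 0).
have yE s : 0 < s -> y s = (E s)^-1 * (G s - G 0) by move=> s0; rewrite /y gt_eqF.
have yM s : 0 < s <= r -> `|y s| <= M.
  move=> /[dup] sr /andP[s0 _]; rewrite yE // normrM gtr0_norm ?invr_gt0 //.
  by rewrite mulrC ler_pdivrMr //; exact: GE.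
have yD s : 0 < s <= r -> deriv_in `[0, r]%classic y s ((f s - y s) / (4 * s ^+ 2)).
  move=> /[dup] sr /andP[s0 s1].
  have sI : `[0, r]%classic s by apply/segE; rewrite ltW.
  apply: (@deriv_in_eq_near0 _ _ (fun s => (E s)^-1 * (G s - G 0))) => //.
    by move=> t _ t0; rewrite yE.
  have En0 : E s != 0 by rewrite gt_eqF.
  have EVD := is_derive_deriv_in `[0, r]%classic (@is_deriveV R E s _ 1 En0 (ED s s0)).
  have sr' : 0 <= s <= r by rewrite ltW.
  have := deriv_inM EVD (deriv_inB (GDr s sr') (deriv_in_cst _ (G 0) s)).
  congr deriv_in; rewrite yE // /F s0 f1f // /GRing.scale /= /E'.
  by field; rewrite En0 gt_eqF.
exists y; split=> [|s /segE sr|s sr]; first by rewrite /y eqxx.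
- have [->|sn0] := eqVneq s 0; last first.
    apply: (deriv_in_cont (yD s _)).
    by case/andP: sr => s0 ->; rewrite lt_neqAle eq_sym sn0 s0.
  apply: (@singular_cont0 R r 0 (r ^+ 2 * M) (fun=> 0) f y
      (fun s => (f s - y s) / (4 * s ^+ 2))) => //.
  + by move=> t _; rewrite normr0.
  + by apply: cf0; apply/segE; rewrite lexx ltW.
  + by rewrite /y eqxx.
  + by move=> t /andP[t0 _]; field; rewrite gt_eqF.
  + move=> t /[dup] tr /andP[t0 t1]; apply: ler_pM => //; [exact: sqr_ge0| |exact: yM].
    by rewrite lerXn2r // nnegrE ltW.
- by split; [exact: yM|exact: yD].
Qed.

End Antiderivative.

(** * Existence *)

Section Contraction.
Context {R : realType}.
Implicit Types (I : set R) (U : set (R -> R)) (T : (R -> R) -> R -> R).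

Lemma exists_half_pow_lt (c e : R) : 0 < e -> exists k, c / 2 ^+ k < e.
Proof.
move=> e0; have [c0|c0] := leP c 0.
  by exists 0%N; rewrite expr0 divr1; apply: le_lt_trans e0.
have ce : 0 <= c / e by rewrite divr_ge0 // ltW.
exists (Num.bound (c / e)); rewrite ltr_pdivrMr ?exprn_gt0 // mulrC -ltr_pdivrMr //.
apply: lt_le_trans (archi_boundP ce) _.
by rewrite -natrX ler_nat ltnW // ltn_expl.
Qed.

(** Banach's theorem for the uniform distance on [I].  Bounded functions on
    [I] are compared only on [I], so the fixed point equation holds there. *)
Lemma uniform_contraction_fixpoint I U T v0 c0 :
  U v0 -> (forall v, U v -> U (T v)) ->
  (forall v, (forall e, 0 < e ->
     exists2 u, U u & forall s, I s -> `|u s - v s| <= e) -> U v) ->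
  (forall u v c, U u -> U v -> (forall s, I s -> `|u s - v s| <= c) ->
     forall s, I s -> `|T u s - T v s| <= c / 2) ->
  (forall s, I s -> `|T v0 s - v0 s| <= c0) ->
  exists2 v, U v & forall s, I s -> T v s = v s.
Proof.
move=> Uv0 UT Ucl Tc Tv0; pose u k := iter k T v0.
have Uu k : U (u k) by elim: k => [//|k]; exact: UT.
have step k s : I s -> `|u k.+1 s - u k s| <= c0 / 2 ^+ k.
  elim: k s => [|k IH] s Is; first by rewrite expr0 divr1; exact: Tv0.
  have := Tc _ _ _ (Uu k.+1) (Uu k) IH s Is.
  by rewrite [2 ^+ k.+1]exprSr invfM mulrA.
pose b k := 2 * c0 / 2 ^+ k.
have bS k : b k = c0 / 2 ^+ k + b k.+1.
  by rewrite /b exprS; field; rewrite expf_neq0.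
have bb k m s : I s -> `|u (k + m)%N s - u k s| <= b k - b (k + m)%N.
  move=> Is; elim: m => [|m IH]; first by rewrite addn0 !subrr normr0.
  rewrite addnS; have := step (k + m)%N s Is; have := bS (k + m)%N.
  have := ler_normD (u (k + m).+1 s - u (k + m)%N s) (u (k + m)%N s - u k s).
  have -> : u (k + m).+1 s - u (k + m)%N s + (u (k + m)%N s - u k s) = u (k + m).+1 s - u k s.
    by ring.
  move: IH; lra.
have c00 s : I s -> 0 <= c0 by move=> /Tv0; exact: le_trans.
have lu k m s : I s -> u k s - b k <= u m s + b m.
  move=> Is; have b0 j : 0 <= b j.
    by rewrite /b divr_ge0 ?exprn_ge0 // mulr_ge0 // (c00 s).
  have := b0 k; have := b0 m.
  have [km|mk] := leqP k m.
    by have := bb k (m - k)%N s Is; rewrite subnKC // ler_norml => /andP[h1 h2]; lra.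
  have := bb m (k - m)%N s Is; rewrite subnKC ?(ltnW mk) // ler_norml => /andP[h1 h2]; lra.
(* [b k] bounds the distance from [u k] to all later terms, so every [u k - b k]
   is below every [u m + b m]; the limit lies in between. *)
pose v s := sup [set u k s - b k | k in setT].
have vu k s : I s -> `|u k s - v s| <= b k.
  move=> Is; rewrite ler_norml; apply/andP; split.
    rewrite lerNl opprB lerBlDr addrC; apply: ge_sup; first by exists (u 0%N s - b 0%N), 0%N.
    by move=> _ [m _ <-]; exact: lu.
  rewrite lerBlDr addrC -lerBlDr; apply: ub_le_sup; last by exists k.
  by exists (u 0%N s + b 0%N) => _ [m _ <-]; exact: lu.
have Uv : U v.
  apply: Ucl => e e0; have [k ke] := exists_half_pow_lt (2 * c0) e0.
  by exists (u k) => // s Is; apply: le_trans (vu k s Is) (ltW ke).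
exists v => // s Is; apply/eqP; rewrite -subr_eq0 -normr_le0; apply/ler_addgt0Pr => e e0.
have [k ke] := exists_half_pow_lt (2 * c0) e0.
rewrite -/(b k) in ke.
have h1 := Tc _ _ _ (Uu k) Uv (vu k) s Is.
have h2 := vu k.+1 s Is.
have h3 : 0 <= c0 / 2 ^+ k by rewrite divr_ge0 ?exprn_ge0 // (c00 s).
have -> : T v s - v s = (u k.+1 s - v s) - (T (u k) s - T v s) by rewrite /u /=; ring.
have b2 : b k = 2 * (c0 / 2 ^+ k) by rewrite /b mulrA.
apply: le_trans (ler_normB _ _) _; have := bS k; rewrite add0r; lra.
Qed.

End Contraction.

Section Profile.
Context {R : realType}.
Implicit Types (H gamma v : R -> R) (r s x q : R).

(** Multiplied by [1 + 4 s^2 v^2] and solved for [4 s^2 v' + v], where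
    [v = gamma'], the equation reads
    [4 s^2 v' + v = profile_rhs n s (H gamma) v]. *)
Definition profile_rhs (n : nat) s q x : R :=
  q + s * ((2 * n%:R - 4) * x - 4 * s * x ^+ 2 * ((1 - 2 * n%:R * s) * x - q)).

(** The factor [s] in front of [|x - x'|] is what makes the nonlinear problem a
    small perturbation of the linear one near 0. *)
Lemma profile_rhs_lip n (B M : R) : 0 <= B -> 0 <= M ->
  exists2 C, 0 < C & forall s q q' x x', 0 <= s <= 1 ->
    `|q'| <= B -> `|x| <= M -> `|x'| <= M ->
    `|profile_rhs n s q x - profile_rhs n s q' x'| <= C * (`|q - q'| + s * `|x - x'|).
Proof.
move=> B0 M0; pose k := `|2 * n%:R - 4 : R|; pose m := 1 + 2 * n%:R : R.
have m0 : 0 <= m by rewrite addr_ge0 // mulr_ge0.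
have k0 : 0 <= k by exact: normr_ge0.
have M2 : 0 <= M ^+ 2 by rewrite sqr_ge0.
have mM : 0 <= m * M ^+ 2 by rewrite mulr_ge0.
have BM : 0 <= B * M by rewrite mulr_ge0.
exists (1 + k + 4 * M ^+ 2 + 12 * (m * M ^+ 2) + 8 * (B * M)); first by lra.
move=> s q q' x x' /andP[s0 s1] q'B xM x'M; pose mu := 1 - 2 * n%:R * s.
have mum : `|mu| <= m.
  have n0 : 0 <= n%:R :> R by [].
  by rewrite /mu /m ler_norml; apply/andP; split; nra.
have -> : profile_rhs n s q x - profile_rhs n s q' x' =
    (q - q') + s * ((2 * n%:R - 4) * (x - x')
      - 4 * s * (mu * (x ^+ 2 + x * x' + x' ^+ 2) * (x - x')
                 - (x ^+ 2 * (q - q') + q' * (x + x') * (x - x')))).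
  by rewrite /profile_rhs /mu; ring.
set dq := `|q - q'|; set dx := `|x - x'|.
have dq0 : 0 <= dq by exact: normr_ge0.
have dx0 : 0 <= dx by exact: normr_ge0.
have x2 : `|x ^+ 2| <= M ^+ 2 by rewrite normrX lerXn2r // nnegrE.
have x'2 : `|x' ^+ 2| <= M ^+ 2 by rewrite normrX lerXn2r // nnegrE.
have xx' : `|x * x'| <= M ^+ 2 by rewrite normrM expr2 ler_pM.
have t1 : `|mu * (x ^+ 2 + x * x' + x' ^+ 2) * (x - x')| <= 3 * (m * M ^+ 2) * dx.
  rewrite normrM ler_wpM2r // normrM.
  have h : `|x ^+ 2 + x * x' + x' ^+ 2| <= 3 * M ^+ 2.
    have := ler_normD (x ^+ 2 + x * x') (x' ^+ 2); have := ler_normD (x ^+ 2) (x * x'); lra.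
  by rewrite mulrCA; apply: ler_pM.
have t2 : `|x ^+ 2 * (q - q')| <= M ^+ 2 * dq by rewrite normrM ler_wpM2r.
have t3 : `|q' * (x + x') * (x - x')| <= 2 * (B * M) * dx.
  rewrite normrM ler_wpM2r // normrM mulrCA; apply: ler_pM => //.
  by have := ler_normD x x'; lra.
have t4 : `|(2 * n%:R - 4) * (x - x')| = k * dx by rewrite normrM.
set a := (2 * n%:R - 4) * (x - x') in t4 *.
set b := mu * _ * (x - x') in t1 *; set c := x ^+ 2 * (q - q') in t2 *.
set d := q' * _ * _ in t3 *.
have u1 : `|b - (c + d)| <= 3 * (m * M ^+ 2) * dx + M ^+ 2 * dq + 2 * (B * M) * dx.
  have := ler_normB b (c + d); have := ler_normD c d; clear - t1 t2 t3; lra.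
have u2 : `|4 * s * (b - (c + d))| <= 4 * (3 * (m * M ^+ 2) * dx + M ^+ 2 * dq + 2 * (B * M) * dx).
  have s4 : `|4 * s| <= 4 by rewrite ger0_norm ?mulr_ge0 //; lra.
  by rewrite normrM; exact: ler_pM.
have u3 : `|a - 4 * s * (b - (c + d))| <=
    k * dx + 4 * (3 * (m * M ^+ 2) * dx + M ^+ 2 * dq + 2 * (B * M) * dx).
  by have := ler_normB a (4 * s * (b - (c + d))); rewrite t4; clear - u2; lra.
have u4 : `|s * (a - 4 * s * (b - (c + d)))| <=
    s * (k * dx + 4 * (3 * (m * M ^+ 2) * dx + M ^+ 2 * dq + 2 * (B * M) * dx)).
  by rewrite normrM ger0_norm // ler_wpM2l.
apply: le_trans (ler_normD _ _) _; rewrite -/dq.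
apply: le_trans (lerD (lexx dq) u4) _.
have sx : 0 <= s * dx by rewrite mulr_ge0.
have e1 : 0 <= M ^+ 2 * dq by rewrite mulr_ge0.
have e2 : s * (M ^+ 2 * dq) <= M ^+ 2 * dq by rewrite ler_piMl.
have e3 : 0 <= k * dq by rewrite mulr_ge0.
have e4 : 0 <= (m * M ^+ 2) * dq by rewrite mulr_ge0.
have e5 : 0 <= (B * M) * dq by rewrite mulr_ge0.
have e6 : 0 <= M ^+ 2 * (s * dx) by rewrite mulr_ge0.
have -> : s * (k * dx + 4 * (3 * (m * M ^+ 2) * dx + M ^+ 2 * dq + 2 * (B * M) * dx)) =
  k * (s * dx) + 12 * ((m * M ^+ 2) * (s * dx)) + 4 * (s * (M ^+ 2 * dq))
  + 8 * ((B * M) * (s * dx)) by ring.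
move: sx e1 e2 e3 e4 e5 e6 mM BM; move: (s * dx) (m * M ^+ 2) (B * M) => p w z.
have -> : (1 + k + 4 * M ^+ 2 + 12 * w + 8 * z) * (dq + p) =
  dq + k * dq + 4 * (M ^+ 2 * dq) + 12 * (w * dq) + 8 * (z * dq)
  + (p + k * p + 4 * (M ^+ 2 * p) + 12 * (w * p) + 8 * (z * p)) by ring.
clear - p w z; lra.
Qed.

Lemma profile_rhs_near n (B M : R) : 0 <= B -> 0 <= M ->
  exists2 C, 0 < C & forall s q x, 0 <= s <= 1 -> `|q| <= B -> `|x| <= M ->
    `|profile_rhs n s q x - q| <= C * s.
Proof.
move=> B0 M0; pose k := `|2 * n%:R - 4 : R|; pose m := 1 + 2 * n%:R : R.
have m0 : 0 <= m by rewrite addr_ge0 // mulr_ge0.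
have k0 : 0 <= k by exact: normr_ge0.
have kM : 0 <= k * M by rewrite mulr_ge0.
have mMB : 0 <= m * M + B by rewrite addr_ge0 // mulr_ge0.
have MM : 0 <= M ^+ 2 * (m * M + B) by rewrite mulr_ge0 // sqr_ge0.
exists (1 + k * M + 4 * (M ^+ 2 * (m * M + B))); first by lra.
move=> s q x /andP[s0 s1] qB xM; pose mu := 1 - 2 * n%:R * s.
have mum : `|mu| <= m.
  have n0 : 0 <= n%:R :> R by [].
  by rewrite /mu /m ler_norml; apply/andP; split; nra.
rewrite /profile_rhs addrC addKr mulrC normrM (ger0_norm s0) ler_wpM2r // -/mu.
have h1 : `|(2 * n%:R - 4) * x| <= k * M by rewrite normrM ler_wpM2l.
have h2 : `|mu * x - q| <= m * M + B.
  apply: le_trans (ler_normB _ _) _; apply: lerD => //.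
  by rewrite normrM; apply: ler_pM.
have h3 : `|x ^+ 2| <= M ^+ 2 by rewrite normrX lerXn2r // nnegrE.
have h4 : `|4 * s * x ^+ 2 * (mu * x - q)| <= 4 * (M ^+ 2 * (m * M + B)).
  have s4 : `|4 * s| <= 4 by rewrite ger0_norm ?mulr_ge0 //; lra.
  by rewrite -mulrA normrM; apply: ler_pM => //; rewrite normrM; exact: ler_pM.
by have := ler_normB ((2 * n%:R - 4) * x) (4 * s * x ^+ 2 * (mu * x - q)); lra.
Qed.

End Profile.

Section Existence.
Context {R : realType}.
Implicit Types (H gamma v : R -> R) (r s x q : R).

Lemma cont_in_comp (I J : set R) f h : (forall x, I x -> J (f x)) ->
  cont_in I f -> cont_in J h -> cont_in I (fun x => h (f x) : R).
Proof.
move=> IJ cf ch x Ix; apply/cont_at_inP => e e0.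
have [d d0 hd] := (cont_at_inP _ _ _).1 (ch _ (IJ _ Ix)) e e0.
have [d' d'0 fd] := (cont_at_inP _ _ _).1 (cf _ Ix) d d0.
by exists d' => // y Iy xy; apply: hd; [exact: IJ|exact: fd].
Qed.

Lemma cont_in_uniform_limit (I : set R) (v : R -> R) :
  (forall e, 0 < e -> exists2 u, cont_in I u & forall s, I s -> `|u s - v s| <= e) ->
  cont_in I v.
Proof.
move=> Hv x Ix; apply/cont_at_inP => e e0.
have e4 : 0 < e / 4 by rewrite divr_gt0.
have [u cu uv] := Hv _ e4.
have [d dd0 Hd] := (cont_at_inP _ _ _).1 (cu x Ix) _ e4.
exists d => // y Iy xy.
have -> : v x - v y = - (u x - v x) + (u x - u y) + (u y - v y) by ring.
apply: le_lt_trans (ler_normD _ _) _.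
have := ler_normD (- (u x - v x)) (u x - u y); rewrite normrN.
by have := uv x Ix; have := uv y Iy; have := Hd y Iy xy; lra.
Qed.

Lemma Ck_in_profile_rhs n (I : set R) k (q v : R -> R) :
  Ck_in I k q -> Ck_in I k v -> Ck_in I k (fun s => profile_rhs n s (q s) (v s)).
Proof.
move=> Cq Cv; rewrite /profile_rhs.
have Cid := Ck_in_id I k; have Cc c := Ck_in_cst I k c.
apply: Ck_inD => //; apply: Ck_inM => //; apply: Ck_inB; first exact: Ck_inM.
apply: Ck_inM; first by apply: Ck_inM; [exact: Ck_inM|exact: Ck_inX].
apply: Ck_inB => //; apply: Ck_inM => //; apply: Ck_inB => //; exact: Ck_inM.
Qed.

(** Near 0 the map sending [v] to the bounded solution [y] of
    [4 s^2 y' + y = profile_rhs n s (H (int v)) v] is a contraction: the right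
    side depends on [v] only through [int v], which is small with [s], and in terms
    with a factor [s], while the solution operator of the linear equation has
    norm 1. *)
Lemma profile_exists n H (d0 L B : R) : 0 < d0 -> 0 < H 0 -> 0 <= L ->
  cont_in `[0, d0]%classic H ->
  (forall x, 0 <= x <= d0 -> `|H x| <= B) ->
  (forall x y, 0 <= x <= d0 -> 0 <= y <= d0 -> `|H x - H y| <= L * `|x - y|) ->
  exists2 r, 0 < r <= 1 & exists gamma v,
    [/\ gamma 0 = 0, v 0 = H 0, cont_in `[0, r]%classic v,
      forall s, 0 <= s <= r ->
        deriv_in `[0, r]%classic gamma s (v s) /\ 0 <= gamma s < d0
    & forall s, 0 < s <= r -> deriv_in `[0, r]%classic v s
        ((profile_rhs n s (H (gamma s)) (v s) - v s) / (4 * s ^+ 2))].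
Proof.
move=> d00; set h := H 0 => h0 L0 cH HB HL.
have B0 : 0 <= B by apply: le_trans (HB 0 _); rewrite ?normr_ge0 // lexx ltW.
have M0 : 0 <= 2 * h by lra.
have [C1 C10 hC1] := profile_rhs_lip n B0 M0.
have [C2 C20 hC2] := profile_rhs_near n B0 M0.
(* The last three conditions on [r] keep [gamma] below [d0], make the map a
   contraction of ratio 1/2, and keep it inside the ball of radius [h / 2]
   around the constant [h]. *)
have [r [r0 r1 rd rC1 rC2]] : exists r, [/\ 0 < r, r <= 1, 2 * h * r < d0,
    C1 * (L + 1) * r <= 1 / 2 & (C2 + L * (2 * h)) * r <= h / 2].
  have p1 : 0 < C1 * (L + 1) by rewrite mulr_gt0 //; lra.
  have p2 : 0 < C2 + L * (2 * h) by have := mulr_ge0 L0 M0; lra.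
  exists (Num.min (Num.min 1 (d0 / (4 * h)))
            (Num.min (1 / 2 / (C1 * (L + 1))) (h / 2 / (C2 + L * (2 * h))))).
  split.
  - by rewrite !lt_min ltr01 !divr_gt0 // mulr_gt0.
  - by rewrite !ge_min lexx.
  - apply: (@le_lt_trans _ _ (2 * h * (d0 / (4 * h)))).
      by rewrite ler_wpM2l // !ge_min lexx orbT.
    by rewrite (_ : _ * _ = d0 / 2); [lra|field; rewrite gt_eqF].
  - by rewrite mulrC -ler_pdivlMr // !ge_min lexx !orbT.
  - by rewrite mulrC -ler_pdivlMr // !ge_min lexx !orbT.
exists r; first by rewrite r0.
set I := `[0, r]%classic.
pose U v := cont_in I v /\ forall s, 0 <= s <= r -> `|v s - h| <= h / 2.
have Uv v s : U v -> 0 <= s <= r -> `|v s| <= 2 * h /\ 0 <= v s.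
  by move=> [_ Hv] /Hv; rewrite ler_norml => /andP[h1 h2]; rewrite ger0_norm; lra.
pose rhs g v s := profile_rhs n s (H (g s)) (v s).
pose spec v (p : (R -> R) * (R -> R)) := U v ->
  [/\ p.1 0 = 0,
      forall s, 0 <= s <= r -> deriv_in I p.1 s (v s) /\ 0 <= p.1 s <= 2 * h * s,
      p.2 0 = h, U p.2 &
      forall s, 0 < s <= r ->
        deriv_in I p.2 s ((rhs p.1 v s - p.2 s) / (4 * s ^+ 2))].
have r0' := ltW r0.
have gd0 (g : R -> R) s : 0 <= s <= r -> 0 <= g s <= 2 * h * s -> 0 <= g s < d0.
  move=> /andP[s0 sr] /andP[-> /= gs]; apply: le_lt_trans gs (le_lt_trans _ rd).
  by rewrite ler_wpM2l.
have gd0W (g : R -> R) s : 0 <= s <= r -> 0 <= g s <= 2 * h * s -> 0 <= g s <= d0.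
  by move=> sr /(gd0 _ _ sr) /andP[-> /ltW ->].
have exT v : exists p, spec v p.
  have [Uvv|?] := pselect (U v); last by exists (v, v).
  have [cv vh] := Uvv.
  have [g [g0 gD]] := antiderivative_in r0 cv.
  have cg : cont_in I g by apply: (@deriv_in_cont_in _ _ _ v) => s /segE; exact: gD.
  have gs s : 0 <= s <= r -> 0 <= g s <= 2 * h * s.
    move=> /andP[s0 sr]; have cgs := cont_in_seg (lexx 0) sr cg.
    have sub x : 0 < x < s -> 0 <= x <= r.
      by case/andP=> x0 xs; rewrite ltW //= (le_trans (ltW xs)).
    have := @deriv_in_lip _ r g v 0 s (2 * h) (lexx _) s0 sr (fun x xs => gD x (sub x xs)).
    move=> /(_ (fun x xs => (Uv v x Uvv (sub x xs)).1) cgs).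
    rewrite g0 !subr0 ler_norml => /andP[_ ->]; rewrite andbT.
    have cgN x : 0 <= x <= s -> cont_at_in I (fun y => - g y) x.
      by move=> /andP[x0 xs]; apply: (deriv_in_cont (deriv_inN (gD x _))); rewrite x0 (le_trans xs).
    rewrite -oppr_le0; have := @deriv_in_nincr _ r (fun y => - g y) (fun y => - v y) 0 s
      (lexx _) s0 sr _ _ cgN; rewrite g0 oppr0; apply.
      by move=> x /sub xr; apply: deriv_inN; exact: gD.
    by move=> x /sub xr; rewrite oppr_le0; exact: (Uv v x Uvv xr).2.
  have gI x : I x -> `[0, d0]%classic (g x).
    by move=> /segE xr; apply/segE; apply: gd0W (gs x xr).
  have crhs : cont_in I (rhs g v).
    exact: (@Ck_in_profile_rhs n I 0 _ _ (cont_in_comp gI cg cH) cv).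
  have crhs' : cont_in I (fun s => rhs g v s - h).
    by apply: cont_inD => //; exact: cont_in_cst.
  have rhs_h s : 0 <= s <= r -> `|rhs g v s - h| <= h / 2.
    move=> /[dup] sr /andP[s0 s1]; have gsr := gd0W g s sr (gs s sr).
    have s01 : 0 <= s <= 1 by rewrite s0 (le_trans s1).
    have e1 := hC2 s _ _ s01 (HB _ gsr) (Uv v s Uvv sr).1.
    have e2 : `|H (g s) - h| <= L * (2 * h * s).
      apply: le_trans (HL _ _ gsr _) _; first by rewrite lexx ltW.
      rewrite ler_wpM2l // subr0; have /andP[g1 g2] := gs s sr.
      by rewrite ger0_norm.
    have -> : rhs g v s - h = (rhs g v s - H (g s)) + (H (g s) - h) by ring.
    apply: le_trans (ler_normD _ _) _; apply: le_trans rC2.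
    have e3 : (C2 + L * (2 * h)) * s <= (C2 + L * (2 * h)) * r.
      by rewrite ler_wpM2l // addr_ge0 ?mulr_ge0 // ltW.
    by apply: le_trans e3; rewrite mulrDl; apply: lerD => //; rewrite -mulrA.
  have h2 : 0 <= h / 2 by rewrite divr_ge0 // ltW.
  have [y [y0 cy yD]] := singular_solve r0 h2 crhs' rhs_h.
  have y00 : y 0 = 0.
    by rewrite y0 /rhs /profile_rhs g0 mul0r addr0 subrr.
  exists (g, fun s => y s + h) => _; split => //=.
  - by move=> s sr; split; [exact: gD|exact: gs].
  - by rewrite y00 add0r.
  - split; first by apply: cont_inD => //; exact: cont_in_cst.
    move=> s /andP[s0 sr]; rewrite addrK; have [->|sn0] := eqVneq s 0.
      by rewrite y00 normr0.
    by apply: (yD s _).1; rewrite sr lt_neqAle eq_sym sn0 s0.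
  - move=> s /[dup] sr /yD[_ D]; have := deriv_inD D (deriv_in_cst I h s).
    by congr deriv_in; rewrite addr0 opprD addrA addrAC.
have [P specP] := choice exT.
pose T v := (P v).2.
have UT v : U v -> U (T v) by move=> /[dup] Uvv /(specP v) [].
have sepI s : I s <-> 0 <= s <= r by exact: segE.
have Uh : U (fun=> h).
  by split; [exact: cont_in_cst|move=> s _; rewrite subrr normr0 divr_ge0 // ltW].
have Ucl v : (forall e, 0 < e -> exists2 u, U u & forall s, I s -> `|u s - v s| <= e) -> U v.
  move=> Hv; split.
    by apply: cont_in_uniform_limit => e /Hv[u [cu _] uv]; exists u.
  move=> s /sepI Is; apply/ler_addgt0Pr => e e0.
  have [u [_ uh] uv] := Hv e e0.
  have -> : v s - h = (u s - h) - (u s - v s) by ring.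
  by apply: le_trans (ler_normB _ _) _; apply: lerD (uh s ((sepI s).1 Is)) (uv s Is).
have Tc u v c : U u -> U v -> (forall s, I s -> `|u s - v s| <= c) ->
    forall s, I s -> `|T u s - T v s| <= c / 2.
  move=> Uu Uvv uv.
  have I0 : I 0 by apply/sepI; rewrite lexx.
  have c0 : 0 <= c by apply: le_trans (uv 0 I0).
  have [gu0 guD Tu0 [_ Tuh] TuD] := specP u Uu.
  have [gv0 gvD Tv0 [_ Tvh] TvD] := specP v Uvv.
  set gu := (P u).1 in gu0 guD TuD; set gv := (P v).1 in gv0 gvD TvD.
  move=> s /sepI /andP[s0 sr]; have [->|sn0] := eqVneq s 0.
    by rewrite /T Tu0 Tv0 subrr normr0 divr_ge0.
  have {}s0 : 0 < s by rewrite lt_neqAle eq_sym sn0.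
  apply: (@singular_max_principle R r 1 (c / 2) (h * 1) (fun=> 1)
    (fun s => rhs gu u s - rhs gv v s) (fun s => T u s - T v s)
    (fun s => (rhs gu u s - T u s) / (4 * s ^+ 2) - (rhs gv v s - T v s) / (4 * s ^+ 2))) => //.
  - by rewrite divr_ge0.
  - by move=> t tr; apply: deriv_inB; [exact: TuD|exact: TvD].
  - by move=> t /andP[t0 _]; field; rewrite gt_eqF.
  - move=> t /andP[t0 tr]; rewrite mul1r.
    have tI : 0 <= t <= r by rewrite ltW.
    have t01 : 0 <= t <= 1 by rewrite ltW //= (le_trans tr).
    have gut := gd0W gu t tI (guD t tI).2; have gvt := gd0W gv t tI (gvD t tI).2.
    have e1 := hC1 t (H (gu t)) (H (gv t)) (u t) (v t) t01 (HB _ gvt)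
      (Uv u t Uu tI).1 (Uv v t Uvv tI).1.
    have e2 : `|gu t - gv t| <= c * t.
      have D x : 0 <= x <= t -> deriv_in I (fun y => gu y - gv y) x (u x - v x).
        move=> /andP[x0 xt]; have xr : 0 <= x <= r by rewrite x0 (le_trans xt).
        by apply: deriv_inB; [exact: (guD x xr).1|exact: (gvD x xr).1].
      have := @deriv_in_lip _ r (fun y => gu y - gv y) (fun y => u y - v y) 0 t c
        (lexx _) (ltW t0) tr _ _ (fun x xt => deriv_in_cont (D x xt)).
      rewrite gu0 gv0 subrr !subr0; apply.
        by move=> x /andP[x0 xt]; apply: D; rewrite !ltW.
      by move=> x /andP[x0 xt]; apply: uv; apply/sepI; rewrite ltW //= (le_trans (ltW xt)).
    have e3 : `|u t - v t| <= c by apply: uv; apply/sepI.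
    have e4 : `|H (gu t) - H (gv t)| <= L * (c * t).
      by apply: le_trans (HL _ _ gut gvt) _; rewrite ler_wpM2l.
    apply: le_trans e1 _.
    apply: (@le_trans _ _ (C1 * (L * (c * t) + t * c))).
      by rewrite ler_wpM2l ?(ltW C10) //; apply: lerD => //; rewrite ler_wpM2l // ltW.
    have -> : C1 * (L * (c * t) + t * c) = C1 * (L + 1) * t * c by ring.
    apply: (@le_trans _ _ (C1 * (L + 1) * r * c)).
      have CL1 : 0 <= C1 * (L + 1) := mulr_ge0 (ltW C10) (addr_ge0 L0 ler01).
      by rewrite ler_wpM2r // ler_wpM2l.
    by apply: le_trans (ler_wpM2r c0 rC1) _; rewrite div1r mulrC.
  - move=> t /andP[t0 tr]; have tI : 0 <= t <= r by rewrite ltW.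
    rewrite mulrC; apply: ler_pM => //; first exact: sqr_ge0.
      have -> : T u t - T v t = (T u t - h) - (T v t - h) by ring.
      apply: le_trans (ler_normB _ _) _.
      by apply: le_trans (lerD (Tuh t tI) (Tvh t tI)) _; rewrite -splitr.
    by rewrite expr_le1 ?(ltW t0) // (le_trans tr).
  - by rewrite s0.
have Th s : I s -> `|T (fun=> h) s - h| <= h / 2.
  by move=> /sepI; have [_ _ _ [_ Hh] _] := specP _ Uh; exact: Hh.
have [v Uvv fixv] := uniform_contraction_fixpoint Uh UT Ucl Tc Th.
have [g0 gD Tv0 _ TvD] := specP v Uvv.
exists (P v).1, v; split=> //.
- by rewrite -fixv //; apply/sepI; rewrite lexx.
- by case: Uvv.
- by move=> s sr; split; [exact: (gD s sr).1|exact: gd0 (gD s sr).2].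
- move=> s /[dup] sr /andP[s0 s1]; have Is : I s by apply/sepI; rewrite ltW.
  by rewrite -[X in _ - X]fixv //; exact: (deriv_in_eq Is fixv (TvD s sr)).
Qed.

End Existence.

(** * Smoothness up to the singular point *)

Section Smoothness.
Context {R : realType}.
Implicit Types (H gamma v : R -> R) (r s x q : R).

Lemma deriv_in_profile_rhs n (I : set R) (q v : R -> R) s p w :
  deriv_in I q s p -> deriv_in I v s w ->
  deriv_in I (fun s => profile_rhs n s (q s) (v s)) s
    (p + (2 * n%:R - 4) * v s - 8 * s * v s ^+ 2 * ((1 - 2 * n%:R * s) * v s - q s)
     + 4 * s ^+ 2 * v s ^+ 2 * (2 * n%:R * v s + p)
     + s * w * ((2 * n%:R - 4) - 8 * s * v s * ((1 - 2 * n%:R * s) * v s - q s)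
                - 4 * s * v s ^+ 2 * (1 - 2 * n%:R * s))).
Proof.
move=> qp vw; have Did := deriv_in_id I s; have Dc c := deriv_in_cst I c s.
have DX := deriv_inB (deriv_inM (deriv_inB (Dc 1) (deriv_inM (Dc (2 * n%:R)) Did)) vw) qp.
have Dv2 := deriv_inM (deriv_inM (Dc 4) Did) (deriv_inM vw vw).
have D := deriv_inD qp
  (deriv_inM Did (deriv_inB (deriv_inM (Dc (2 * n%:R - 4)) vw) (deriv_inM Dv2 DX))).
by move: D; congr deriv_in; rewrite /=; ring.
Qed.

(** Once [v] is of class C^k, its derivative solves a linear equation of the
    kind treated by [singular_Ck] with coefficients of class C^k, because the
    only term of the differentiated right side that contains [v'] carries a
    factor [s]. *)
Lemma profile_Ck n H (d0 r : R) gamma v : 0 < r ->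
  (forall j x, 0 <= x <= d0 -> is_derive x 1 (derive1n j H) (derive1n j.+1 H x)) ->
  v 0 = H 0 -> cont_in `[0, r]%classic v ->
  (forall s, 0 <= s <= r -> deriv_in `[0, r]%classic gamma s (v s) /\ 0 <= gamma s <= d0) ->
  (forall s, 0 < s <= r -> deriv_in `[0, r]%classic v s
        ((profile_rhs n s (H (gamma s)) (v s) - v s) / (4 * s ^+ 2))) ->
  forall k, Ck_in `[0, r]%classic k v.
Proof.
move=> r0 HD v0 cv gD vD; elim=> [//|k Cv]; set I := `[0, r]%classic in cv gD vD Cv *.
have Cg : Ck_in I k.+1 gamma by exists v => // s /segE /gD[].
have CH j : Ck_in I k (fun s => derive1n j H (gamma s)).
  apply: (@Ck_in_comp _ I k gamma (fun j => derive1n j H)); last exact: Ck_inW.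
  by move=> i s /segE /gD[_ gs]; exact: HD.
have CH0 : Ck_in I k (fun s => H (gamma s)) by exact: (CH 0%N).
have Cid := Ck_in_id I k; have Cc c := Ck_in_cst I k c.
pose q s := H (gamma s); pose p s := derive1n 1 H (gamma s) * v s.
pose rhs s := profile_rhs n s (q s) (v s).
pose X s := (1 - 2 * n%:R * s) * v s - q s.
pose b s := 8 - (2 * n%:R - 4) + 8 * s * v s * X s + 4 * s * v s ^+ 2 * (1 - 2 * n%:R * s).
pose f s := p s + (2 * n%:R - 4) * v s - 8 * s * v s ^+ 2 * X s
     + 4 * s ^+ 2 * v s ^+ 2 * (2 * n%:R * v s + p s).
have Cp : Ck_in I k p by apply: Ck_inM => //; exact: (CH 1%N).
have Cmu : Ck_in I k (fun s => 1 - 2 * n%:R * s).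
  by apply: Ck_inB => //; exact: Ck_inM.
have CX : Ck_in I k X by apply: Ck_inB => //; exact: Ck_inM.
have Cv2 : Ck_in I k (fun s => v s ^+ 2) by exact: Ck_inX.
have Cm c : Ck_in I k (fun s => c * s) by exact: Ck_inM.
have Cb : Ck_in I k b.
  apply: Ck_inD; first apply: Ck_inD => //.
    by apply: Ck_inM => //; exact: Ck_inM.
  by apply: Ck_inM => //; exact: Ck_inM.
have Cf : Ck_in I k f.
  apply: Ck_inD.
    apply: Ck_inB; first by apply: Ck_inD => //; exact: Ck_inM.
    by apply: Ck_inM => //; exact: Ck_inM.
  apply: Ck_inM; last by apply: Ck_inD => //; exact: Ck_inM.
  by apply: Ck_inM => //; apply: Ck_inM => //; exact: Ck_inX.
(* At 0, [w] takes the value that the differentiated equation prescribes. *)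
pose w s := if s == 0 then f 0 else (rhs s - v s) / (4 * s ^+ 2).
have wE s : 0 < s -> w s = (rhs s - v s) / (4 * s ^+ 2) by move=> s0; rewrite /w gt_eqF.
have crhs : cont_in I (fun s => rhs s - v s).
  by apply: (@Ck_in_cont _ I k); apply: Ck_inB => //; exact: Ck_in_profile_rhs.
have [K K0 hK] := cont_in_bounded (ltW r0) crhs.
pose rhs' s := f s + s * w s * ((2 * n%:R - 4) - 8 * s * v s * X s
                - 4 * s * v s ^+ 2 * (1 - 2 * n%:R * s)).
have Cw : Ck_in I k w.
  apply: (@singular_Ck R k r (K / 4) b f w (fun s =>
    (rhs' s - w s) * (4 * s ^+ 2)^-1 + (rhs s - v s) * (- (8 * s / (4 * s ^+ 2) ^+ 2)))) => //.
  - by rewrite /w eqxx.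
  - move=> s /[dup] sr /andP[s0 s1].
    have sr' : 0 <= s <= r by rewrite ltW.
    have sI : I s by exact/segE.
    apply: (@deriv_in_eq_near0 _ _ (fun s => (rhs s - v s) * (4 * s ^+ 2)^-1)) => //.
      by move=> t _ t0; rewrite wE.
    have vw : deriv_in I v s (w s) by rewrite wE //; exact: vD.
    apply: deriv_inM; last exact: deriv_in_inv_4sqr.
    apply: deriv_inB => //; apply: deriv_in_profile_rhs => //.
    by have [gs gsd] := gD s sr'; exact: (deriv_in_comp (HD 0%N _ gsd) gs).
  - move=> s /[dup] sr /andP[s0 s1].
    have -> : rhs s - v s = w s * (4 * s ^+ 2) by rewrite wE //; field; rewrite gt_eqF.
    by rewrite /rhs' /b; field; rewrite gt_eqF.
  - move=> s /[dup] sr /andP[s0 s1]; rewrite wE // normrM.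
    have s2 : 0 < s ^+ 2 by rewrite exprn_gt0.
    rewrite (@gtr0_norm _ (_^-1)); last by rewrite invr_gt0 mulr_gt0.
    rewrite (_ : s ^+ 2 * _ = `|rhs s - v s| / 4); last by field; rewrite gt_eqF.
    by rewrite ler_wpM2r // hK // s1 ltW.
exists w => // s /segE/andP[s0 sr]; have [->|sn0] := eqVneq s 0.
  apply: deriv_in_at0 => //.
    by move=> t /[dup] tr /andP[t0 _]; rewrite wE //; exact: vD.
  by apply: (Ck_in_cont Cw); apply/segE; rewrite lexx ltW.
have {}s0 : 0 < s by rewrite lt_neqAle eq_sym sn0.
by rewrite wE //; apply: vD; rewrite s0.
Qed.

End Smoothness.

(** * Uniqueness *)

Section Uniqueness.
Context {R : realType}.
Implicit Types (H gamma v : R -> R) (r s x q : R).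

(** For two solutions with differences [delta] and [eta = delta'], the energy
    [E = 2 s^2 eta^2 + delta^2] vanishes at 0 and satisfies [E' <= D^2 E]: the
    damping term [- eta^2] of [E'] absorbs half of [D s eta^2 + D |delta eta|].
    Gronwall's argument then gives [E = 0]. *)
Lemma profile_unique n H (d0 r L B : R) g1 g2 v1 v2 : 0 < r <= 1 -> 0 <= L -> 0 <= B ->
  (forall x, 0 <= x <= d0 -> `|H x| <= B) ->
  (forall x y, 0 <= x <= d0 -> 0 <= y <= d0 -> `|H x - H y| <= L * `|x - y|) ->
  (forall g v, g = g1 /\ v = v1 \/ g = g2 /\ v = v2 ->
    [/\ g 0 = 0, cont_in `[0, r]%classic v,
      forall s, 0 <= s <= r -> deriv_in `[0, r]%classic g s (v s) /\ 0 <= g s <= d0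
    & forall s, 0 < s <= r -> deriv_in `[0, r]%classic v s
        ((profile_rhs n s (H (g s)) (v s) - v s) / (4 * s ^+ 2))]) ->
  forall s, 0 <= s <= r -> g1 s = g2 s.
Proof.
move=> /andP[r0 r1] L0 B0 HB HL sol; set I := `[0, r]%classic in sol *.
have [g10 cv1 gD1 vD1] := sol g1 v1 (or_introl (conj erefl erefl)).
have [g20 cv2 gD2 vD2] := sol g2 v2 (or_intror (conj erefl erefl)).
have [M1 M10 hM1] := cont_in_bounded (ltW r0) cv1.
have [M2 M20 hM2] := cont_in_bounded (ltW r0) cv2.
have M0 : 0 <= M1 + M2 by lra.
have [C C0 hC] := profile_rhs_lip n B0 M0.
(* [C L] and [C] come from the Lipschitz bound on the right side; the constant 4
   covers the terms [4 s eta^2] and [2 eta delta]. *)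
pose D := C * (L + 1) + 4.
pose eta s := v1 s - v2 s; pose delta s := g1 s - g2 s.
pose rhs1 s := profile_rhs n s (H (g1 s)) (v1 s).
pose rhs2 s := profile_rhs n s (H (g2 s)) (v2 s).
pose E s := (2 * (s * s)) * (eta s * eta s) + delta s * delta s.
pose eta' s := (rhs1 s - v1 s) / (4 * s ^+ 2) - (rhs2 s - v2 s) / (4 * s ^+ 2).
pose E' s := (2 * (1 * s + s * 1)) * (eta s * eta s)
  + (2 * (s * s)) * (eta' s * eta s + eta s * eta' s) + (eta s * delta s + delta s * eta s).
have CL : 0 <= C * L by rewrite mulr_ge0 // ltW.
have cI s : 0 <= s <= r -> cont_at_in I v1 s /\ cont_at_in I v2 s.
  by move=> sr; split; [apply: cv1|apply: cv2]; exact/segE.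
have deltaD s : 0 <= s <= r -> deriv_in I delta s (eta s).
  by move=> sr; apply: deriv_inB; [exact: (gD1 s sr).1|exact: (gD2 s sr).1].
have cdelta : cont_in I delta by apply: (@deriv_in_cont_in _ _ _ eta) => s /segE; exact: deltaD.
have ceta : cont_in I eta by apply: (@Ck_inB _ I 0).
have cE : cont_in I E.
  have cid := @cont_in_id R I.
  apply: cont_inD; last exact: cont_inM.
  apply: cont_inM; last exact: cont_inM.
  by apply: cont_inM; [exact: cont_in_cst|exact: cont_inM].
have ED s : 0 < s <= r -> deriv_in I E s (E' s).
  move=> /[dup] sr /andP[s0 s1]; have sr' : 0 <= s <= r by rewrite ltW.
  have De : deriv_in I eta s (eta' s) by apply: deriv_inB; [exact: vD1|exact: vD2].
  apply: deriv_inD; last by apply: deriv_inM; exact: deltaD.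
  apply: deriv_inM; last exact: deriv_inM.
  by apply: deriv_inZ; apply: deriv_inM; exact: deriv_in_id.
have EE' s : 0 < s <= r -> E' s <= D ^+ 2 * E s.
  move=> /[dup] sr /andP[s0 s1]; have sr' : 0 <= s <= r by rewrite ltW.
  have s01 : 0 <= s <= 1 by rewrite ltW //= (le_trans s1).
  have [_ gs1] := gD1 s sr'; have [_ gs2] := gD2 s sr'.
  have m1 := hM1 s sr'; have m2 := hM2 s sr'.
  have h1 : `|rhs1 s - rhs2 s| <= C * (L * `|delta s| + s * `|eta s|).
    apply: le_trans (hC s _ _ _ _ s01 (HB _ gs2) _ _) _.
    - by apply: le_trans m1 _; rewrite lerDl.
    - by apply: le_trans m2 _; rewrite lerDr.
    rewrite ler_wpM2l ?(ltW C0) // lerD2r; exact: HL.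
  have -> : E' s = 4 * s * eta s ^+ 2 - eta s ^+ 2 + eta s * (rhs1 s - rhs2 s)
      + 2 * (eta s * delta s).
    by rewrite /E' /eta' /eta; field; rewrite gt_eqF.
  have h2 : eta s * (rhs1 s - rhs2 s) <= `|eta s| * (C * (L * `|delta s| + s * `|eta s|)).
    by apply: le_trans (ler_norm _) _; rewrite normrM ler_wpM2l.
  have h3 : eta s * delta s <= `|eta s| * `|delta s|.
    by apply: le_trans (ler_norm _) _; rewrite normrM.
  have -> : D ^+ 2 * E s = D ^+ 2 * (2 * s ^+ 2 * `|eta s| ^+ 2 + `|delta s| ^+ 2).
    by rewrite !real_normK ?num_real // /E; ring.
  have e2 : eta s ^+ 2 = `|eta s| ^+ 2 by rewrite real_normK ?num_real.
  rewrite e2; move: h2 h3; have := normr_ge0 (eta s); have := normr_ge0 (delta s).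
  move: (`|eta s|) (`|delta s|) (eta s * _) (eta s * _) => x y t z y0 x0 h2 h3.
  have s0' := ltW s0.
  have xy : 0 <= x * y by rewrite mulr_ge0.
  have sx : 0 <= s * x ^+ 2 by rewrite mulr_ge0 ?sqr_ge0.
  have f1 : 4 * s * x ^+ 2 - x ^+ 2 + z + 2 * t <= - x ^+ 2 + D * (s * x ^+ 2) + D * (x * y).
    have c1 : 0 <= C * (x * y) by rewrite mulr_ge0 // ltW.
    have c2 : 0 <= C * L * (s * x ^+ 2) by rewrite mulr_ge0.
    have Dxy : D * (s * x ^+ 2) + D * (x * y) = 4 * (s * x ^+ 2) + 4 * (x * y)
       + C * (s * x ^+ 2) + C * L * (s * x ^+ 2) + C * L * (x * y) + C * (x * y).
      by rewrite /D; ring.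
    have e3 : x * (C * (L * y + s * x)) = C * L * (x * y) + C * (s * x ^+ 2) by ring.
    rewrite e3 in h2; rewrite -[X in _ <= X]addrA Dxy; clear - h2 h3 c1 c2 xy sx. lra.
  apply: (le_trans f1).
  have q1 := sqr_ge0 (D * s * x - x); have q2 := sqr_ge0 (D * y - x).
  have q3 := sqr_ge0 (D * s * x); have q4 := sqr_ge0 (D * y).
  have -> : D ^+ 2 * (2 * s ^+ 2 * x ^+ 2 + y ^+ 2) = 2 * (D * s * x) ^+ 2 + (D * y) ^+ 2 by ring.
  have p1 : (D * s * x - x) ^+ 2 = (D * s * x) ^+ 2 - 2 * (D * (s * x ^+ 2)) + x ^+ 2 by ring.
  have p2 : (D * y - x) ^+ 2 = (D * y) ^+ 2 - 2 * (D * (x * y)) + x ^+ 2 by ring.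
  clear - q1 q2 q3 q4 p1 p2; lra.
pose lam := D ^+ 2.
have expD s : deriv_in I (fun t => expR (- (lam * t))) s (expR (- (lam * s)) * - lam).
  have Dl : is_derive s (1 : R) (fun t : R => - (lam * t)) (- lam).
    by apply: is_derive_eq; rewrite /GRing.scale /=; ring.
  apply: is_derive_deriv_in; exact: (@is_derive1_comp _ expR (fun t => - (lam * t))).
move=> s /andP[s0 sr].
have cg t : 0 <= t <= s -> cont_at_in I (fun t => E t * expR (- (lam * t))) t.
  move=> /andP[t0 ts]; have tI : I t by apply/segE; rewrite t0 (le_trans ts).
  by apply: cvgM; [exact: cE|exact: deriv_in_cont (expD t)].
have := @deriv_in_nincr _ r (fun t => E t * expR (- (lam * t)))
  (fun t => E' t * expR (- (lam * t)) + E t * (expR (- (lam * t)) * - lam)) 0 s (lexx _) s0 sr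
  _ _ cg.
have -> : E 0 = 0 by rewrite /E /delta g10 g20 subrr !mul0r mulr0 mul0r addr0.
rewrite mul0r pmulr_lle0 ?expR_gt0 // => HE.
have E0 : E s <= 0.
  apply: HE.
    by move=> t /andP[t0 ts]; apply: deriv_inM; [apply: ED; rewrite t0 (le_trans (ltW ts))|exact: expD].
  move=> t /andP[t0 ts]; have tr : 0 < t <= r by rewrite t0 (le_trans (ltW ts)).
  have -> : E' t * expR (- (lam * t)) + E t * (expR (- (lam * t)) * - lam)
     = (E' t - lam * E t) * expR (- (lam * t)) by ring.
  by rewrite pmulr_lle0 ?expR_gt0 // subr_le0; exact: EE'.
have d2 : delta s ^+ 2 <= 0.
  have := mulr_ge0 (sqr_ge0 s) (sqr_ge0 (eta s)).
  by move: E0; rewrite /E -!expr2; lra.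
have /eqP : delta s ^+ 2 = 0 by apply/eqP; rewrite eq_le d2 sqr_ge0.
by rewrite expf_eq0 /= subr_eq0 => /eqP.
Qed.

End Uniqueness.

(** * Asymptotic expansions at 0 *)

Section Asymptotic.
Context {R : realType}.
Implicit Types (f g : R -> R) (a b h : nat -> R) (r s : R).

(** [f s = sum_(k < m) a k s^k + O(s^m)].  The bound on the remainder is uniform
    on [0, r] and not only near 0, so that no interval has to be shrunk when
    expansions are combined. *)
Definition expands r m f a :=
  exists2 C, 0 <= C & forall s, 0 <= s <= r ->
    `|f s - (\poly_(i < m) a i).[s]| <= C * s ^+ m.

Definition asymptotic r f a := forall m, expands r m f a.

Lemma expands_eq r m f g a b : (forall s, 0 <= s <= r -> f s = g s) ->
  (forall i, (i < m)%N -> a i = b i) -> expands r m f a -> expands r m g b.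
Proof.
move=> fg ab [C C0 hC]; exists C => // s sr; rewrite -fg //.
have <- : \poly_(i < m) a i = \poly_(i < m) b i.
  by apply/polyP => i; rewrite !coef_poly; case: ifP => // /ab.
exact: hC.
Qed.

Lemma asymptotic_eq r f g a b : (forall s, 0 <= s <= r -> f s = g s) ->
  a =1 b -> asymptotic r f a -> asymptotic r g b.
Proof. by move=> fg ab fa m; exact: expands_eq (fa m). Qed.

Lemma horner_bounded r (p : {poly R}) : 0 <= r ->
  exists2 K, 0 <= K & forall s, 0 <= s <= r -> `|p.[s]| <= K.
Proof.
move=> r0; elim/poly_ind: p => [|p c [K K0 hK]].
  by exists 0 => // s _; rewrite horner0 normr0.
exists (K * r + `|c|); first by rewrite addr_ge0 // mulr_ge0.
move=> s /[dup] sr /andP[s0 s1]; rewrite hornerMXaddC.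
apply: le_trans (ler_normD _ _) _; rewrite lerD2r normrM.
by apply: ler_pM => //; [exact: hK|rewrite ger0_norm].
Qed.

Lemma expands_bounded r m f a : 0 <= r -> expands r m f a ->
  exists2 K, 0 <= K & forall s, 0 <= s <= r -> `|f s| <= K.
Proof.
move=> r0 [C C0 hC]; have [K K0 hK] := horner_bounded (\poly_(i < m) a i) r0.
exists (C * r ^+ m + K); first by rewrite addr_ge0 // mulr_ge0 // exprn_ge0.
move=> s /[dup] sr /andP[s0 s1].
rewrite -[f s](subrK (\poly_(i < m) a i).[s]); apply: le_trans (ler_normD _ _) _.
apply: lerD; last exact: hK.
by apply: le_trans (hC s sr) _; rewrite ler_wpM2l // lerXn2r // nnegrE.
Qed.

Lemma expandsD r m f g a b : expands r m f a -> expands r m g b ->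
  expands r m (fun s => f s + g s) (fun k => a k + b k).
Proof.
move=> [C C0 hC] [K K0 hK]; exists (C + K); first exact: addr_ge0.
move=> s sr; have -> : \poly_(i < m) (a i + b i) = \poly_(i < m) a i + \poly_(i < m) b i.
  by apply/polyP => i; rewrite coefD !coef_poly; case: ifP; rewrite ?addr0.
rewrite hornerD opprD addrACA mulrDl; apply: le_trans (ler_normD _ _) _.
by apply: lerD; [exact: hC|exact: hK].
Qed.

Lemma expandsZ r m f a c : expands r m f a ->
  expands r m (fun s => c * f s) (fun k => c * a k).
Proof.
move=> [C C0 hC]; exists (`|c| * C); first exact: mulr_ge0.
move=> s sr; have -> : \poly_(i < m) (c * a i) = c *: \poly_(i < m) a i.
  by apply/polyP => i; rewrite coefZ !coef_poly; case: ifP; rewrite ?mulr0.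
by rewrite hornerZ -mulrBr normrM -mulrA ler_wpM2l // hC.
Qed.

(** The product of the truncations differs from the truncated product by a multiple
    of [s^m]. *)
Lemma expandsM r m f g a b : 0 <= r -> expands r m f a -> expands r m g b ->
  expands r m (fun s => f s * g s) (fps_mul a b).
Proof.
move=> r0 fa gb; have [G G0 hG] := expands_bounded r0 gb.
case: fa gb => C C0 hC [D D0 hD].
set P := \poly_(i < m) a i in hC *; set Q := \poly_(i < m) b i in hD *.
have [K K0 hK] := horner_bounded P r0.
have [T T0 hT] := horner_bounded (drop_poly m (P * Q)) r0.
exists (C * G + K * D + T); first by rewrite !addr_ge0 // mulr_ge0.
move=> s /[dup] sr /andP[s0 s1].
have -> : \poly_(i < m) fps_mul a b i = take_poly m (P * Q).
  apply/polyP => i; rewrite coef_poly coef_take_poly; case: ifP => // im.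
  rewrite coefM; apply: eq_bigr => j _.
  have ji : (j <= i)%N by rewrite -ltnS.
  by rewrite !coef_poly (leq_ltn_trans ji im) (leq_ltn_trans (leq_subr _ _) im).
have PQ := congr1 (horner^~ s) (poly_take_drop m (P * Q)).
rewrite /= hornerD !hornerM hornerXn in PQ.
have -> : f s * g s - (take_poly m (P * Q)).[s] =
    (f s - P.[s]) * g s + P.[s] * (g s - Q.[s]) + (drop_poly m (P * Q)).[s] * s ^+ m.
  move: PQ; move: (take_poly _ _).[s] (drop_poly _ _).[s] => u v E.
  have -> : u = P.[s] * Q.[s] - v * s ^+ m by rewrite -E addrK.
  ring.
apply: le_trans (ler_normD _ _) _; rewrite [X in _ <= X]mulrDl; apply: lerD; last first.
  by rewrite normrM (ger0_norm (exprn_ge0 _ s0)) ler_wpM2r ?exprn_ge0 // hT.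
apply: le_trans (ler_normD _ _) _; rewrite [X in _ <= X]mulrDl; apply: lerD; rewrite normrM.
  by rewrite mulrAC; apply: ler_pM => //; [exact: hC|exact: hG].
by rewrite -mulrA; apply: ler_pM => //; [exact: hK|exact: hD].
Qed.

Lemma asymptoticX r f a : 0 <= r -> asymptotic r f a ->
  asymptotic r (fun s => s * f s) (fps_X a).
Proof.
move=> r0 fa [|m].
  have [C C0 hC] := fa 0%N; exists (r * C); first exact: mulr_ge0.
  move=> s /[dup] sr /andP[s0 s1]; have := hC s sr.
  rewrite !poly_def !big_ord0 horner0 !subr0 !expr0 !mulr1 normrM => h.
  by apply: ler_pM => //; rewrite ger0_norm.
have [C C0 hC] := fa m; exists C => // s /[dup] sr /andP[s0 s1].
have -> : \poly_(i < m.+1) fps_X a i = 'X * \poly_(i < m) a i.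
  by apply/polyP => -[|i]; rewrite coefXM !coef_poly //= ltnS.
rewrite hornerM hornerX -mulrBr normrM ger0_norm // exprS mulrCA.
by rewrite ler_wpM2l // hC.
Qed.

Lemma expands_fps_exp r m f a j : 0 <= r -> expands r m f a ->
  expands r m (fun s => f s ^+ j) (fps_exp a j).
Proof.
move=> r0 fa; elim: j => [|j IH].
  exists 1 => // s /andP[s0 s1]; rewrite expr0; case: m {fa} => [|m].
    by rewrite poly_def big_ord0 horner0 subr0 expr0 normr1 mulr1.
  have -> : \poly_(i < m.+1) fps_exp a 0 i = 1.
    by apply/polyP => -[|i]; rewrite coef_poly coef1 /fps_exp /= ?if_same.
  by rewrite hornerC subrr normr0 mul1r exprn_ge0.
by apply: expands_eq (expandsM r0 fa IH) => // s _; rewrite exprS.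
Qed.

Lemma expands_sum r m N (F : nat -> R -> R) (c : nat -> nat -> R) :
  (forall j, (j < N)%N -> expands r m (F j) (c j)) ->
  expands r m (fun s => \sum_(j < N) F j s) (fun k => \sum_(j < N) c j k).
Proof.
elim: N => [|N IH] Fc.
  exists 0 => // s _; rewrite big_ord0.
  have -> : \poly_(i < m) (\sum_(j < 0) c j i) = 0 :> {poly R}.
    by apply/polyP => i; rewrite coef_poly coef0 big_ord0; case: ifP.
  by rewrite horner0 subrr normr0 mul0r.
have := expandsD (IH (fun j jN => Fc j (ltnW jN))) (Fc N (ltnSn _)).
by apply: expands_eq => [s _|i _]; rewrite big_ord_recr.
Qed.

Lemma fps_exp_gt a j k : a 0%N = 0 -> (k < j)%N -> fps_exp a j k = 0.
Proof.
move=> a0; elim: j k => [//|j IH] k kj.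
rewrite /= /fps_mul big1 // => -[i ik] _ /=; case: i ik => [|i] ik; first by rewrite a0 mul0r.
by rewrite IH ?mulr0 // (@leq_trans k) // ltn_subrL /= (leq_trans _ (ik : (i.+1 <= k)%N)).
Qed.

(** The outer function enters through estimates along the values of the inner one,
    so that one lemma serves both [H], expanded by Taylor's formula, and
    [x |-> 1 / (1 + x)], expanded as a geometric sum. *)
Lemma asymptotic_comp r f a h (Phi : R -> R) : 0 <= r -> a 0%N = 0 ->
  asymptotic r f a ->
  (forall m, exists2 C, 0 <= C & forall s, 0 <= s <= r ->
     `|Phi (f s) - \sum_(j < m) h j * f s ^+ j| <= C * `|f s| ^+ m) ->
  asymptotic r (fun s => Phi (f s)) (fps_comp h a).
Proof.
move=> r0 a0 fa hPhi m.
have [C C0 hC] := hPhi m; have [D D0 hD] := fa 1%N.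
have fs s : 0 <= s <= r -> `|f s| <= D * s.
  by move=> /hD; rewrite poly_def big_ord1 a0 scale0r horner0 subr0 expr1.
have S : expands r m (fun s => \sum_(j < m) h j * f s ^+ j)
    (fun k => \sum_(j < m) h j * fps_exp a j k).
  apply: (@expands_sum r m m (fun j s => h j * f s ^+ j) (fun j k => h j * fps_exp a j k)).
  by move=> j _; apply/expandsZ/expands_fps_exp.
have rem : expands r m (fun s => Phi (f s) - \sum_(j < m) h j * f s ^+ j) (fun=> 0).
  exists (C * D ^+ m); first by rewrite mulr_ge0 // exprn_ge0.
  move=> s /[dup] sr /andP[s0 s1].
  have -> : \poly_(i < m) 0 = 0 :> {poly R}.
    by apply/polyP => i; rewrite coef_poly coef0; case: ifP.
  rewrite horner0 subr0; apply: le_trans (hC s sr) _.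
  rewrite -mulrA -exprMn ler_wpM2l // lerXn2r ?nnegrE ?mulr_ge0 //; exact: fs.
apply: expands_eq (expandsD rem S) => [s _|k km]; first by rewrite subrK.
rewrite add0r /fps_comp (big_ord_widen _ (fun j => h j * fps_exp a j k) km).
rewrite [LHS](bigID (fun j : 'I_m => (j < k.+1)%N)) /= [X in _ + X]big1 ?addr0 //.
by move=> j; rewrite -leqNgt => kj; rewrite fps_exp_gt // mulr0.
Qed.

(** The remainder of the geometric series of ratio [- u], for [u >= 0], is at most
    its first omitted term. *)
Lemma asymptotic_inv1D r u a : 0 <= r -> a 0%N = 0 ->
  (forall s, 0 <= s <= r -> 0 <= u s) -> asymptotic r u a ->
  asymptotic r (fun s => (1 + u s)^-1) (fps_inv1D a).
Proof.
move=> r0 a0 u0 ua; apply: (@asymptotic_comp r u a _ (fun x => (1 + x)^-1)) => // m.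
exists 1 => // s /u0 us; rewrite mul1r.
have u1 : 1 + u s != 0 by rewrite gt_eqF //; lra.
have -> : \sum_(j < m) (-1) ^+ j * u s ^+ j = (1 - (- u s) ^+ m) / (1 + u s).
  apply: (mulfI u1); rewrite mulrCA divff // mulr1 -opprB subrX1 -mulNr opprD !opprK addrC.
  by congr (_ * _); apply: eq_bigr => j _; rewrite [RHS]exprNn.
rewrite -[X in `|X - _|]mul1r -mulrBl opprB addrCA subrr addr0 normrM normrX normrN.
by rewrite ler_piMr ?exprn_ge0 // gtr0_norm ?invr_gt0 ?invf_le1 //; lra.
Qed.

(** Taylor's formula.  The sequence [F] lists a function and its successive
    derivatives; integrating the expansion of [F 1] gives that of [F 0]. *)
Lemma asymptotic_taylor r (F : nat -> R -> R) : 0 <= r ->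
  (forall j s, 0 <= s <= r -> deriv_in `[0, r]%classic (F j) s (F j.+1 s)) ->
  asymptotic r (F 0%N) (fun k => F k 0 / k`!%:R).
Proof.
move=> r0 FD m; elim: m F FD => [|m IH] F FD.
  have cF : cont_in `[0, r]%classic (F 0%N).
    by apply: (@deriv_in_cont_in _ _ _ (F 1%N)) => s /segE; exact: FD.
  have [K K0 hK] := cont_in_bounded r0 cF; exists K => // s sr.
  by rewrite poly_def big_ord0 horner0 subr0 expr0 mulr1 hK.
have [C C0 hC] := IH (fun j => F j.+1) (fun j => FD j.+1).
set p := \poly_(i < m) _ in hC.
pose P := \poly_(i < m.+1) (F i 0 / i`!%:R).
have P' : P^`() = p.
  apply/polyP => i; rewrite coef_deriv !coef_poly ltnS; case: ifP => // _; last first.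
    by rewrite mul0rn.
  rewrite -mulr_natr factS natrM; field.
  by rewrite addrC natr1 !pnatr_eq0 -lt0n fact_gt0.
exists C => // s /andP[s0 sr].
have D t : 0 <= t <= s -> deriv_in `[0, r]%classic (fun t => F 0%N t - P.[t]) t (F 1%N t - p.[t]).
  move=> /andP[t0 ts]; apply: deriv_inB; first by apply: FD; rewrite t0; lra.
  apply: is_derive_deriv_in; rewrite -P' derivE derive1E.
  by apply: derivableP; exact: derivable_horner.
have := @deriv_in_lip _ r (fun t => F 0%N t - P.[t]) (fun t => F 1%N t - p.[t])
  0 s (C * s ^+ m) (lexx _) s0 sr _ _ (fun x xs => deriv_in_cont (D x xs)).
have -> : F 0%N 0 - P.[0] = 0.
  by rewrite horner_coef0 coef_poly /= fact0 divr1 subrr.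
rewrite !subr0 -mulrA -exprSr; apply.
  by move=> t /andP[t0 ts]; apply: D; rewrite !ltW.
move=> t /andP[t0 ts]; apply: le_trans (hC t _) _; first by rewrite ltW //=; lra.
by rewrite ler_wpM2l // lerXn2r // ?nnegrE ltW.
Qed.

(** If [a k] is the first coefficient that is not yet known to vanish, the expansion
    of order [k + 1] bounds it by [C s] for all small [s]. *)
Lemma asymptotic0_eq0 r a : 0 < r -> asymptotic r (fun=> 0) a -> forall k, a k = 0.
Proof.
move=> r0 ha k; elim/ltn_ind: k => k IH.
have [C C0 hC] := ha k.+1; apply/eqP; rewrite -normr_le0; apply/ler_addgt0Pr => e e0.
pose s := Num.min r (e / (C + 1)).
have C1 : 0 < C + 1 by lra.
have s0 : 0 < s by rewrite lt_min r0 divr_gt0.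
have sr : s <= r by rewrite ge_min lexx.
have Cs : C * s <= e.
  have : s * (C + 1) <= e by rewrite -ler_pdivlMr // ge_min lexx orbT.
  lra.
have := hC s; rewrite ltW //= sr => /(_ isT).
have -> : \poly_(i < k.+1) a i = a k *: 'X^k.
  apply/polyP => i; rewrite coef_poly coefZ coefXn ltnS.
  have [-> |ik] := eqVneq i k; first by rewrite leqnn mulr1.
  by rewrite mulr0; case: ifP => // ik'; rewrite IH // ltn_neqAle ik.
rewrite hornerZ hornerXn sub0r normrN normrM (ger0_norm (exprn_ge0 _ (ltW s0))).
by rewrite exprS mulrA ler_pM2r ?exprn_gt0 // add0r => h; apply: le_trans h Cs.
Qed.

End Asymptotic.

(** * The initial value problem *)

Section IVP.
Context {R : realType}.
Implicit Types (H gamma v : R -> R) (r s : R).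

Lemma ode_denominator_neq0 (s x : R) : 1 + 4 * s ^+ 2 * x ^+ 2 != 0.
Proof.
by have := mulr_ge0 (sqr_ge0 s) (sqr_ge0 x); rewrite -mulrA => h; rewrite gt_eqF //; lra.
Qed.

Lemma ode_profile_rhs n s q x w :
  (1 - 2 * n%:R * s) * x - q + 4 * ((s * x + s ^+ 2 * w) / (1 + 4 * s ^+ 2 * x ^+ 2))
  = (4 * s ^+ 2 * w + x - profile_rhs n s q x) / (1 + 4 * s ^+ 2 * x ^+ 2) :> R.
Proof.
have d0 := ode_denominator_neq0 s x.
by rewrite /profile_rhs; field.
Qed.

Lemma solves_ivp_profile n H (d0 r : R) gamma : 0 < r -> solves_ivp n H d0 r gamma ->
  let v := derive_in `[0, r]%classic gamma in
  [/\ gamma 0 = 0, cont_in `[0, r]%classic v,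
    forall s, 0 <= s <= r -> deriv_in `[0, r]%classic gamma s (v s) /\ 0 <= gamma s <= d0
  & forall s, 0 < s <= r -> deriv_in `[0, r]%classic v s
      ((profile_rhs n s (H (gamma s)) (v s) - v s) / (4 * s ^+ 2))].
Proof.
move=> r0 [sm gd g0 eq] v.
have D k s : 0 <= s <= r -> deriv_in `[0, r]%classic (derive_in_n `[0, r]%classic k gamma) s
    (derive_in_n `[0, r]%classic k.+1 gamma s) by exact: smooth_in_deriv.
split=> //.
- by apply: (@deriv_in_cont_in _ _ _ (derive_in_n `[0, r]%classic 2 gamma)) => s /segE; exact: (D 1%N).
- move=> s sr; split; first exact: (D 0%N).
  by have /andP[h1 h2] := gd s ((segE _ _).2 sr); rewrite h1 ltW.
- move=> s /andP[s0 s1]; have sr : 0 <= s <= r by rewrite ltW.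
  move: (eq s ((segE _ _).2 sr)); rewrite ode_profile_rhs => /eqP.
  have d1 := ode_denominator_neq0 s (derive_in_n `[0, r]%classic 1 gamma s).
  rewrite mulf_eq0 invr_eq0 (negbTE d1) orbF subr_eq0 => /eqP E.
  move: (D 1%N s sr); congr deriv_in.
  by rewrite -[v]/(derive_in_n `[0, r]%classic 1 gamma) -E; field; rewrite gt_eqF.
Qed.

Lemma profile_solves_ivp n H (d0 r : R) gamma v : 0 < r ->
  gamma 0 = 0 -> v 0 = H 0 -> (forall k, Ck_in `[0, r]%classic k v) ->
  (forall s, 0 <= s <= r -> deriv_in `[0, r]%classic gamma s (v s) /\ 0 <= gamma s < d0) ->
  (forall s, 0 < s <= r -> deriv_in `[0, r]%classic v s
        ((profile_rhs n s (H (gamma s)) (v s) - v s) / (4 * s ^+ 2))) ->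
  solves_ivp n H d0 r gamma.
Proof.
move=> r0 g0 v0 Cv gD vD.
have gv s : 0 <= s <= r -> derive_in `[0, r]%classic gamma s = v s.
  by move=> sr; apply: (derive_in_val r0 sr); have [] := gD s sr.
split=> //.
- apply: Ck_in_smooth => // -[|k].
    by apply: (@deriv_in_cont_in _ _ _ v) => s /segE /gD[].
  by exists v => // s /segE /gD[].
- by move=> s /segE /gD[].
- move=> s /segE sr; rewrite ode_profile_rhs.
  rewrite -[derive_in_n `[0, r]%classic 1 gamma]/(derive_in `[0, r]%classic gamma) gv //.
  have [->|sn0] := eqVneq s 0.
    by rewrite /profile_rhs g0 v0 expr0n /= !(mulr0, mul0r, addr0, add0r) subrr mul0r.
  have s0 : 0 < s by case/andP: sr => s0 _; rewrite lt_neqAle eq_sym sn0.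
  have sr' : 0 < s <= r by rewrite s0; case/andP: sr.
  have -> : derive_in_n `[0, r]%classic 2 gamma s =
      (profile_rhs n s (H (gamma s)) (v s) - v s) / (4 * s ^+ 2).
    apply: (derive_in_val r0 sr); apply: deriv_in_eq (vD s sr'); first exact/segE.
    by move=> t /segE /gv.
  rewrite (_ : _ + _ - _ = 0) ?mul0r //; field; exact: sn0.
Qed.

(** All the operations of the equation carry asymptotic expansions to
    asymptotic expansions, so the left side of the equation at a smooth solution
    has the expansion [ode_fps] of the Taylor series of the solution; as this
    left side vanishes, so do all these coefficients. *)
Lemma taylor_formal_solution n H (d0 r : R) gamma : 0 < d0 -> 0 < r ->
  (forall j x, 0 <= x <= d0 -> is_derive x 1 (derive1n j H) (derive1n j.+1 H x)) ->
  solves_ivp n H d0 r gamma ->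
  formal_solution n H (fun k => derive_in_n `[0, r]%classic k gamma 0).
Proof.
move=> d00 r0 HD sol; have [sm gd g0 eq] := sol.
set F := fun k => derive_in_n `[0, r]%classic k gamma.
pose g := egf (fun k => F k 0); rewrite /formal_solution -/F -/g.
have gE k : g k = F k 0 / k`!%:R by case: k => [|k] //; rewrite /F /= g0 mul0r.
have rW := ltW r0.
have FD k s : 0 <= s <= r -> deriv_in `[0, r]%classic (F k) s (F k.+1 s).
  exact: smooth_in_deriv.
have fact0 k : k`!%:R != 0 :> R by rewrite pnatr_eq0 -lt0n fact_gt0.
have a0 : asymptotic r gamma g.
  by apply: asymptotic_eq (asymptotic_taylor rW FD) => // k.
have a1 : asymptotic r (F 1%N) (fps_deriv g).
  apply: asymptotic_eq (@asymptotic_taylor R r (fun j => F j.+1) rW (fun j => FD j.+1)) => // k.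
  rewrite /fps_deriv gE factS natrM; field.
  by rewrite fact0 /= nat1r pnatr_eq0.
have a2 : asymptotic r (F 2%N) (fps_deriv (fps_deriv g)).
  apply: asymptotic_eq (@asymptotic_taylor R r (fun j => F j.+2) rW (fun j => FD j.+2)) => // k.
  rewrite /fps_deriv gE !factS !natrM; field.
  by rewrite fact0 /= nat1r -natrD !pnatr_eq0.
have aX := asymptoticX rW a1.
have aXX := asymptoticX rW (asymptoticX rW a2).
have aH : asymptotic r (fun s => H (gamma s)) (fps_comp (taylor H) g).
  apply: asymptotic_comp => // m.
  have HD' j x : 0 <= x <= d0 -> deriv_in `[0, d0]%classic (derive1n j H) x (derive1n j.+1 H x).
    by move=> xd; apply/is_derive_deriv_in/HD.
  have [C C0 hC] := asymptotic_taylor (ltW d00) HD' m.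
  exists C => // s /segE /gd /andP[gs0 gsd]; rewrite (ger0_norm gs0).
  have := hC (gamma s); rewrite gs0 (ltW gsd) => /(_ isT).
  by rewrite horner_poly.
have au : asymptotic r (fun s => 4 * ((s * F 1%N s) * (s * F 1%N s)))
    (fun m => 4 * fps_mul (fps_X (fps_deriv g)) (fps_X (fps_deriv g)) m).
  by move=> m; apply/expandsZ/expandsM.
have ainv : asymptotic r (fun s => (1 + 4 * ((s * F 1%N s) * (s * F 1%N s)))^-1)
    (fps_inv1D (fun m => 4 * fps_mul (fps_X (fps_deriv g)) (fps_X (fps_deriv g)) m)).
  apply: (asymptotic_inv1D rW _ _ au).
    by rewrite /fps_mul big_ord1 mul0r mulr0.
  by move=> s _; rewrite mulr_ge0 // -expr2 sqr_ge0.
apply: (asymptotic0_eq0 r0) => m.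
have := expandsD (expandsD (expandsD (a1 m) (expandsZ (- (2 * n%:R)) (aX m))) (expandsZ (-1) (aH m)))
  (expandsZ 4 (expandsM rW (expandsD (aX m) (aXX m)) (ainv m))).
apply: expands_eq => [s /segE sr|k _]; last by rewrite /ode_fps mulN1r mulNr.
rewrite -(eq s sr) -/F mulN1r.
have -> : 4 * (s * F 1%N s * (s * F 1%N s)) = 4 * s ^+ 2 * F 1%N s ^+ 2 by ring.
by rewrite -[derive_in_n _ 1 gamma s]/(F 1%N s) -[derive_in_n _ 2 gamma s]/(F 2%N s); ring.
Qed.

End IVP.

Local Notation R := (Rdefinitions.R : realType).

(* s0 is chosen before the hypersurface: it depends only on H (and n). *)
Theorem theorem4p2 (n : nat) (hn : (2 <= n)%N)
    (H : R -> R) (d0 : R) (hd0 : 0 < d0)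
    (Hpos : forall d : R, 0 <= d < d0 -> 0 < H d)
    (Hdec : forall d : R, 0 <= d < d0 -> derive1 H d < 0)
    (Hd0 : H d0 = 0)
    (Han : forall d : R, 0 <= d <= d0 -> analytic_at H d)
    (A : nat -> R) (hA : formal_solution n H A) :
  exists2 s0 : R, 0 < s0 &
    forall Gamma Om : set 'rV[R]_n.+1,
      isoparametric Gamma -> side Gamma Om ->
      (forall d : R, 0 <= d <= d0 -> parallel_mean_curvature Gamma Om d (H d)) ->
    exists gamma : R -> R,
      [/\ solves_ivp n H d0 s0 gamma,
          forall gamma2, solves_ivp n H d0 s0 gamma2 ->
            forall s : R, 0 <= s <= s0 -> gamma2 s = gamma s &
          forall k, (1 <= k)%N -> derive_in_n `[0, s0]%classic k gamma 0 = A k].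
Proof.
have HD j x : 0 <= x <= d0 -> is_derive x 1 (derive1n j H) (derive1n j.+1 H x).
  by move=> xd; apply/analytic_at_is_derive1n/Han.
have HDin j x : 0 <= x <= d0 -> deriv_in `[0, d0]%classic (derive1n j H) x (derive1n j.+1 H x).
  by move=> xd; apply/is_derive_deriv_in/HD.
have cH j : cont_in `[0, d0]%classic (derive1n j H).
  by apply: (@deriv_in_cont_in _ _ _ (derive1n j.+1 H)) => x /segE; exact: HDin.
have [B B0 HB] := cont_in_bounded (ltW hd0) (cH 0%N).
have [L L0 HL'] := cont_in_bounded (ltW hd0) (cH 1%N).
have HL x y : 0 <= x <= d0 -> 0 <= y <= d0 -> `|H x - H y| <= L * `|x - y|.
  wlog xy : x y / x <= y => [W|].
    by have [/W //|/ltW /W h] := leP x y; rewrite distrC [X in _ * X]distrC => ? ?; exact: h.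
  move=> /andP[x0 _] /andP[_ yd]; rewrite distrC [X in _ * X]distrC (ger0_norm (_ : 0 <= y - x)) ?subr_ge0 //.
  apply: (deriv_in_lip x0 xy yd _ _ (cont_in_seg x0 yd (cH 0%N))).
    by move=> t /andP[xt ty]; apply: (HDin 0%N); apply/andP; split; lra.
  by move=> t /andP[xt ty]; apply: HL'; apply/andP; split; lra.
have H0 : 0 < H 0 by apply: Hpos; rewrite lexx.
have [r /[dup] r01 /andP[r0 r1] [gamma [v [g0 v0 cv gD vD]]]] :=
  profile_exists n hd0 H0 L0 (cH 0%N) HB HL.
have gD' s : 0 <= s <= r -> deriv_in `[0, r]%classic gamma s (v s) /\ 0 <= gamma s <= d0.
  by move=> /gD[D /andP[h1 h2]]; rewrite h1 ltW.
have Cv := profile_Ck r0 HD v0 cv gD' vD.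
have sol := profile_solves_ivp r0 g0 v0 Cv gD vD.
exists r => // Gamma Om _ _ _; exists gamma; split=> //.
- move=> gamma2 /(solves_ivp_profile r0) sol2.
  have sol1 := solves_ivp_profile r0 sol.
  apply: (profile_unique (n := n) r01 L0 B0 HB HL) => g w [[-> ->]|[-> ->]]; [exact: sol2|exact: sol1].
- exact: formal_solution_unique (taylor_formal_solution hd0 r0 HD sol) hA.
Qed.
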